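(* Let $G$ be a nontrivial finite group that is neither cyclic of prime-power order nor generalized quaternion. For every integer $n\geq 1$, there exist finite free $G$-simplicial complexes $X$ and $Y$ such that $$\operatorname{ind}_G X=\operatorname{ind}_G Y=n\qquad\text{and}\qquad \operatorname{ind}_G(X*Y)\leq n+1.$$ In particular, $$\delta_G(X,Y)=\operatorname{ind}_G X+\operatorname{ind}_G Y+1-\operatorname{ind}_G(X*Y)\geq n.$$ Hence the join defect $\delta_G$ is unbounded as $X$ and $Y$ range over finite free $G$-simplicial complexes.
   Context: A generalized quaternion group here is the 2-group $Q_{2^k}$ of order $2^k$, $k\geq 3$ (including $Q_8$). A finite free $G$-simplicial complex is a finite simplicial complex with a simplicial $G$-action that is free on its geometric realization; as a $G$-space it is identified with its geometric realization. For $k\geq 0$, let $E_kG=G^{*(k+1)}$ be the $(k+1)$-fold topological join of the discrete group $G$, equipped with the diagonal $G$-action (left multiplication on each copy of $G$). For a free $G$-space $X$, the topological index is $$\operatorname{ind}_G(X)=\min\{k\geq 0 : \text{there exists a continuous } G\text{-equivariant map } X\to E_kG\}.$$ The join of two topological spaces $X$ and $Y$ is the quotient $X*Y=(X\times Y\times[0,1])/\sim$, where $(x,y_1,0)\sim(x,y_2,0)$ and $(x_1,y,1)\sim(x_2,y,1)$; the class of $(x,y,t)$ is denoted $(1-t)x\oplus ty$. If $X$ and $Y$ are $G$-spaces, $X*Y$ carries the diagonal action $g\cdot((1-t)x\oplus ty)=(1-t)(gx)\oplus t(gy)$. The join defect of $X$ and $Y$ is $\delta_G(X,Y)=\operatorname{ind}_G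 X+\operatorname{ind}_G Y+1-\operatorname{ind}_G(X*Y)$. *)

(* Defs.v *)
From HB Require Import structures.
From mathcomp Require Import all_boot all_order all_algebra.
From mathcomp Require Import all_fingroup all_solvable.
From mathcomp Require Import all_classical all_reals all_analysis.

Set Implicit Arguments.
Unset Strict Implicit.
Unset Printing Implicit Defensive.

Import Order.TTheory GRing.Theory Num.Theory.
Import numFieldNormedType.Exports.

Local Open Scope classical_set_scope.
Local Open Scope quotient_scope.
Local Open Scope ring_scope.

(* MathComp's {action gT &-> T} are right actions; the actions below are left
   actions. *)
Record gspace (gT : finGroupType) := GSpace {
  gspace_sort :> topologicalType;
  gact : gT -> gspace_sort -> gspace_sort;
  gact1 : forall x, gact 1%g x = x;
  gactM : forall g h x, gact (g * h)%g x = gact g (gact h x);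
  gact_continuous : forall g, continuous (gact g) }.

Definition gfree (gT : finGroupType) (X : gspace gT) : Prop :=
  forall (g : gT) (x : X), gact g x = x -> g = 1%g.

Definition gmap (gT : finGroupType) (X Y : gspace gT) (f : X -> Y) : Prop :=
  continuous f /\ forall g x, f (gact g x) = gact g (f x).

Section Join.
Variable R : realType.

Definition unit_interval : set R := `[0, 1].

Section JoinSpace.
Variables X Y : topologicalType.

Definition join_pre : topologicalType := (X * Y * unit_interval)%type.

(* The equivalence relation generated by (x, y1, 0) ~ (x, y2, 0) and
   (x1, y, 1) ~ (x2, y, 1). *)
Definition join_rel : rel join_pre := fun p q =>
  [|| p == q,
      [&& set_val p.2 == 0, set_val q.2 == 0 & p.1.1 == q.1.1]
    | [&& set_val p.2 == 1, set_val q.2 == 1 & p.1.2 == q.1.2]].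

Lemma join_rel_refl : reflexive join_rel.
Proof. by move=> p; rewrite /join_rel eqxx. Qed.

Lemma join_rel_sym : symmetric join_rel.
Proof.
move=> p q; rewrite /join_rel (eq_sym p) (eq_sym p.1.1) (eq_sym p.1.2).
by rewrite (andbCA (_ == 0)) (andbCA (_ == 1)).
Qed.

Lemma join_rel_trans : transitive join_rel.
Proof.
move=> q p r; rewrite /join_rel.
case/or3P => [/eqP -> //|/and3P[p0 q0 /eqP e]|/and3P[p1 q1 /eqP e]];
  case/or3P => [/eqP <-|/and3P[q0' r0 /eqP e']|/and3P[q1' r1 /eqP e']].
- by rewrite p0 q0 e eqxx orbT.
- by rewrite p0 r0 e e' eqxx orbT.
- by move: q1'; rewrite (eqP q0) eq_sym oner_eq0.
- by rewrite p1 q1 e eqxx !orbT.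
- by move: q1; rewrite (eqP q0') eq_sym oner_eq0.
- by rewrite p1 r1 e e' eqxx !orbT.
Qed.

Canonical join_equiv := EquivRel join_rel join_rel_refl join_rel_sym join_rel_trans.

Definition join_space : topologicalType :=
  quotient_topology {eq_quot join_equiv}.

Definition join_pi (p : join_pre) : join_space :=
  \pi_({eq_quot join_equiv}) p.

End JoinSpace.

Section JoinAction.
Variables (gT : finGroupType) (X Y : gspace gT).

Definition join_pre_act (g : gT) (p : join_pre X Y) : join_pre X Y :=
  (gact g p.1.1, gact g p.1.2, p.2).

Definition join_act (g : gT) (z : join_space X Y) : join_space X Y :=
  join_pi (join_pre_act g (generic_quotient.repr z)).

Lemma join_actE g p : join_act g (join_pi p) = join_pi (join_pre_act g p).
Proof.
rewrite /join_act; apply/eqmodP => /=.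
have : join_rel (generic_quotient.repr (join_pi p)) p.
  by apply/eqmodP; rewrite reprK.
rewrite /join_rel /join_pre_act /=.
case/or3P => [/eqP -> |/and3P[-> -> /eqP ->]|/and3P[-> -> /eqP ->]];
  by rewrite ?eqxx ?orbT.
Qed.

Lemma join_piP (z : join_space X Y) : exists p, z = join_pi p.
Proof. by exists (generic_quotient.repr z); rewrite /join_pi reprK. Qed.

Lemma join_act1 z : join_act 1%g z = z.
Proof.
have [[[x y] t] ->] := join_piP z.
by rewrite join_actE /join_pre_act /= !gact1.
Qed.

Lemma join_actM g h z : join_act (g * h)%g z = join_act g (join_act h z).
Proof.
have [[[x y] t] ->] := join_piP z.
by rewrite !join_actE /join_pre_act /= !gactM.
Qed.

Lemma join_act_continuous g : continuous (join_act g).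
Proof.
have /quotient_continuous : continuous
    (join_act g \o \pi_(quotient_topology {eq_quot join_equiv X Y})); last exact.
have -> : join_act g \o \pi_(quotient_topology {eq_quot join_equiv X Y})
          = @join_pi X Y \o join_pre_act g.
  by apply/funext => p; exact: join_actE.
have act1_cont : continuous (fun p : join_pre X Y => gact g p.1.1).
  move=> p; apply: (@continuous_comp _ _ _ (fun p : join_pre X Y => p.1.1)).
    by apply: continuous_comp; exact: cvg_fst.
  exact: gact_continuous.
have act2_cont : continuous (fun p : join_pre X Y => gact g p.1.2).
  move=> p; apply: (@continuous_comp _ _ _ (fun p : join_pre X Y => p.1.2)).
    by apply: continuous_comp; [exact: cvg_fst|exact: cvg_snd].
  exact: gact_continuous.
have act12_cont : continuous
    (fun p : join_pre X Y => (gact g p.1.1, gact g p.1.2)).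
  move=> p; apply: (@cvg_pair _ _ _ (nbhs p) (nbhs (gact g p.1.1))
    (nbhs (gact g p.1.2))); [exact: act1_cont|exact: act2_cont].
move=> p; apply: continuous_comp; last exact: pi_continuous.
apply: (@cvg_pair _ _ _ (nbhs p) (nbhs (gact g p.1.1, gact g p.1.2))
  (nbhs p.2)); [exact: act12_cont|exact: cvg_snd].
Qed.

Definition gjoin : gspace gT :=
  GSpace join_act1 join_actM join_act_continuous.

End JoinAction.
End Join.

Section Index.
Variables (R : realType) (gT : finGroupType).

Definition gdisc_act (g : gT) (x : discrete_topology gT) :
    discrete_topology gT := (g * (x : gT))%g.

Lemma gdisc_act_continuous g : continuous (gdisc_act g).
Proof. by apply/continuousP => A _; exact: discrete_open. Qed.

Definition gdisc : gspace gT :=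
  @GSpace gT (discrete_topology gT) gdisc_act (@mul1g gT)
    (fun g h x => esym (mulgA g h x)) gdisc_act_continuous.

Fixpoint EG (k : nat) : gspace gT :=
  if k is k'.+1 then gjoin R (EG k') gdisc else gdisc.

Definition maps_to_EG (X : gspace gT) : pred nat :=
  fun k => `[< exists f : X -> EG k, gmap f >].

(* The minimum of a set of natural numbers, with value +oo if X maps to no
   EG k. *)
Definition ind (X : gspace gT) : \bar int :=
  if pselect (exists k, maps_to_EG X k) is left h
  then ((ex_minn h)%:Z)%:E else +oo%E.

Definition join_defect (X Y : gspace gT) : \bar int :=
  (ind X + ind Y + 1%:E - ind (gjoin R X Y))%E.

End Index.

(* A finite abstract simplicial complex on the vertex set gvert, with a
   simplicial left action. Complexes are nonempty: the quotient defining the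
   join is empty as soon as one factor is, so that the join defect would not be
   meaningful for the empty complex. *)
Record gcomplex (gT : finGroupType) := GComplex {
  gvert : finType;
  gface : {set {set gvert}};
  gvert_inhabited : (0 < #|gvert|)%N;
  gface_neq0 : finset.set0 \notin gface;
  gface_vertex : forall v, [set v]%SET \in gface;
  gface_sub : forall s t : {set gvert},
    s \in gface -> t \subset s -> t != finset.set0 -> t \in gface;
  vact : gT -> gvert -> gvert;
  vact1 : forall v, vact 1%g v = v;
  vactM : forall g h v, vact (g * h)%g v = vact g (vact h v);
  vact_simplicial : forall g (s : {set gvert}),
    s \in gface -> [set vact g v | v in s]%SET \in gface }.

Section Realization.
Variables (R : realType) (gT : finGroupType) (K : gcomplex gT).

(* Barycentric coordinates; the complex being finite, its topology is the
   subspace topology inherited from R^V. *)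
Definition geom_set : set {ptws gvert K -> R} :=
  [set x : {ptws gvert K -> R} |
    [/\ forall v, 0 <= x v, \sum_v x v = 1
      & finset (fun v => x v != 0) \in gface K]].

Definition geom_space : topologicalType := geom_set.

(* The affine extension of the vertex action, which carries the vertex v to
   vact g v. *)
Definition geom_push (g : gT) (x : {ptws gvert K -> R}) :
    {ptws gvert K -> R} := fun v => x (vact g^-1%g v).

Lemma vactK (g : gT) : cancel (@vact _ K g) (vact g^-1%g).
Proof. by move=> v; rewrite -vactM mulVg vact1. Qed.

Lemma vactVK (g : gT) : cancel (vact g^-1%g) (@vact _ K g).
Proof. by move=> v; rewrite -vactM mulgV vact1. Qed.

Lemma geom_push_subproof g (x : geom_space) :
  geom_push g (set_val x) \in geom_set.
Proof.
apply/mem_set; have [x0 x1 xK] := set_valP x; split => [v||].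
- exact: x0.
- rewrite -x1 (reindex (@vact _ K g)) /=.
    by apply: eq_bigr => v _; rewrite /geom_push vactK.
  by exists (vact g^-1%g) => v _; [exact: vactK|exact: vactVK].
- rewrite (_ : finset _ =
    [set vact g v | v in finset (fun v => set_val x v != 0%R)]%SET).
    exact: vact_simplicial.
  apply/setP => v; rewrite inE /geom_push; apply/idP/imsetP => [xv|[w]].
    by exists (vact g^-1%g v); rewrite ?inE ?vactVK.
  by rewrite inE => xw ->; rewrite vactK.
Qed.

Definition geom_act (g : gT) (x : geom_space) : geom_space :=
  exist _ (geom_push g (set_val x)) (geom_push_subproof g x).

Lemma geom_act1 x : geom_act 1%g x = x.
Proof.
by apply/val_inj/funext => v; rewrite /= /geom_push invg1 vact1.
Qed.

Lemma geom_actM g h x : geom_act (g * h)%g x = geom_act g (geom_act h x).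
Proof.
by apply/val_inj/funext => v; rewrite /= /geom_push invMg vactM.
Qed.

Lemma geom_act_continuous g : continuous (geom_act g).
Proof.
apply: continuous_comp_initial => x.
apply/cvg_sup; first exact/fmap_filter/nbhs_filter.
move=> v; move: x.
apply: (@continuous_comp_initial _ _ _ (fun y : {ptws gvert K -> R} => y v)
  (set_val \o geom_act g)) => x.
apply: (@continuous_comp _ _ _ (set_val : geom_space -> {ptws gvert K -> R})
  (fun y : {ptws gvert K -> R} => y (vact g^-1%g v))).
  exact: initial_continuous.
exact: (@proj_continuous (gvert K) (fun=> R)).
Qed.

Definition geom : gspace gT := GSpace geom_act1 geom_actM geom_act_continuous.

End Realization.

Record free_gcomplex (R : realType) (gT : finGroupType) := FreeGComplex {
  free_gcomplex_val :> gcomplex gT;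
  free_gcomplexP : gfree (geom R free_gcomplex_val) }.

(* Main.v *)
Require Import Defs.
From mathcomp Require Import all_boot all_order all_algebra.
From mathcomp Require Import all_fingroup all_solvable.
From mathcomp Require Import all_classical all_reals all_analysis.
From mathcomp Require Import ring lra zify.

(** Why the theorem holds.

    A finite group is neither cyclic of prime-power order nor generalized
    quaternion exactly when it has two cyclic subgroups A and B of prime order
    such that no conjugate of A meets B outside the identity.  This is
    [disjoint_prime_cycles]: two prime divisors of the order give such
    subgroups by Cauchy's theorem; in a p-group take for B a central subgroup
    of order p and for A any other subgroup of order p, which exists because
    Ohm_1(G) has order p only in the excluded cases.

    For a subgroup H let X(H, n) be the induced complex G x_H E_nH.  It is the
    subcomplex of E_nG on the vertices (i, x), where i <= n is the copy of G
    and x is in G, whose simplices have all their group elements in one left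
    coset of H ([coset_complex]).  The complexes are X = X(A, n) and
    Y = X(B, n).

    Upper bounds.  As a subcomplex of E_nG, X(H, n) maps to it
    ([coset_complex_map]).  A point of X lies over a coset xA and a point of Y
    over a coset yB.  The stabilizer of a pair (xA, yB) is an intersection of
    conjugates of A and B, hence trivial, so there is an equivariant locally
    constant map c from X x Y to G.  Inserting the point c(x, y) in the middle
    of the segment from x to y gives an equivariant map from X * Y to
    E_nG * G = E_(n+1)G: the first half of the segment goes from the image of x
    in E_nG to c(x, y), the second half from c(x, y) to the image of y
    ([join_map], [coset_join_map]).

    Lower bound.  Let p be the order of A = <a>, and suppose that an
    equivariant map f from X to E_kG with k < n exists.  The following
    Borsuk-Ulam argument, in chains with coefficients in F_p, refutes it
    ([no_map_to_small_EG]).  Write D_k for a - 1 when k is odd and for the norm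
    1 + a + ... + a^(p-1) when k > 0 is even; D_0 is the identity.
    - In the source there are chains z_k with boundary(z_(k+1)) = D_k z_k: cone
      off the cycle D_k z_k from the vertex (k, 1).  Barycentric subdivision
      preserves these relations.
    - In the target, label a point of E_kG by a pair (i, x) with a large
      coordinate.  If two points are close and their labels have the same i,
      then the labels agree.  On tuples of such labels there are alternating
      cochains psi_k with coboundary(psi_k) = D_(k+1) psi_(k+1), because A acts
      freely on labels.
    - Pulling psi_k back along the labelling of a fine subdivision, the number
      <D_k psi_k, z_k> does not depend on k, since
      <D_(k+1) psi_(k+1), z_(k+1)> = <coboundary psi_k, z_(k+1)>
      = <psi_k, D_k z_k>.  It is 1 at the start, and it is 0 once tuples have
      more entries than there are values of i, since alternating cochains
      vanish on tuples with a repeated entry.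

    Chains only occur through the functionals they define on cochains, so that
    no free module is needed: a cochain is any function on tuples, and a
    subdivision operator acts on cochains by duality. *)

Set Implicit Arguments.
Unset Strict Implicit.
Unset Printing Implicit Defensive.

Import Order.TTheory GRing.Theory Num.Theory.
Import numFieldNormedType.Exports.
(* The left action gact of the definitions is meant, not the one of group
   actions in the library. *)
Import Defs.
Local Open Scope classical_set_scope.
Local Open Scope quotient_scope.
Local Open Scope ring_scope.

(** * Alternating cochains on tuples *)

Section Coboundary.
Variables (F : comNzRingType) (T : eqType).
Implicit Types (phi psi : seq T -> F) (s : seq T).

(** The usual alternating sum over the faces of s.  Recursion on the first entry
    states that the boundary of a cone is its base minus the cone over the
    boundary of the base; most identities below are this formula and an
    induction on the tuple. *)
Fixpoint cobd phi s : F :=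
  if s is b :: t then phi t - cobd (fun u => phi (b :: u)) t else 0.

Lemma cobd_face phi psi s :
  (forall t, subseq t s -> (size t).+1 = size s -> phi t = psi t) ->
  cobd phi s = cobd psi s.
Proof.
elim: s phi psi => //= b s IH phi psi eq_ff.
rewrite eq_ff //; last exact: subseq_cons.
congr (_ - _); case: s IH eq_ff => // c s IH eq_ff.
by apply: IH => t sts szt; apply: eq_ff; rewrite /= ?eqxx ?szt.
Qed.

Lemma cobd0 s : cobd (fun=> 0) s = 0.
Proof. by elim: s => //= b s ->; rewrite subr0. Qed.

Lemma cobdB phi psi s :
  cobd (fun t => phi t - psi t) s = cobd phi s - cobd psi s.
Proof.
elim: s phi psi => [|b s IH] phi psi /=; first by rewrite subr0.
by rewrite IH !opprD !opprK addrACA.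
Qed.

Lemma cobdN phi s : cobd (fun t => - phi t) s = - cobd phi s.
Proof. by elim: s phi => [|b s IH] phi /=; rewrite ?oppr0 // IH opprD. Qed.

Lemma cobd_sum n (phi : 'I_n -> seq T -> F) s :
  cobd (fun t => \sum_(j < n) phi j t) s = \sum_(j < n) cobd (phi j) s.
Proof.
elim: s phi => [|b s IH] phi /=; first by rewrite big1.
by rewrite IH -sumrB.
Qed.

Lemma cobd_cobd phi s : cobd (cobd phi) s = 0.
Proof.
elim: s phi => //= b s IH phi.
by rewrite cobdB IH subr0 subrr.
Qed.

(** Only adjacent entries are exchanged or equal, which is what the recursive
    form of [cobd] sees; vanishing on repetitions does not follow from the sign
    rule in characteristic 2. *)
Definition alternating phi :=
  (forall u x y v, phi (u ++ x :: y :: v) = - phi (u ++ y :: x :: v)) /\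
  (forall u x v, phi (u ++ x :: x :: v) = 0).

Lemma alternating_cons phi b :
  alternating phi -> alternating (fun t => phi (b :: t)).
Proof.
by case=> phiN phi0; split=> u *;
  [exact: (phiN (b :: u))|exact: (phi0 (b :: u))].
Qed.

Lemma alternating_cobd phi : alternating phi -> alternating (cobd phi).
Proof.
have H u : forall phi, alternating phi ->
    (forall x y v, cobd phi (u ++ x :: y :: v) = - cobd phi (u ++ y :: x :: v)) /\
    (forall x v, cobd phi (u ++ x :: x :: v) = 0).
  elim: u => [|b u IH] {}phi altphi; have [phiN phi0] := altphi.
    split=> [x y v|x v] /=.
      rewrite (_ : (fun u => _) = (fun u => - phi [:: y, x & u])).
        by rewrite cobdN; ring.
      by apply/funext => u; exact: (phiN [::]).
    rewrite (_ : (fun u => _) = (fun=> 0)) ?cobd0; first by ring.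
    by apply/funext => u; exact: (phi0 [::]).
  have [IHN IH0] := IH _ (alternating_cons b altphi).
  split=> [x y v|x v] /=; last by rewrite IH0 phi0 subr0.
  by rewrite IHN phiN opprD.
by move=> /H altphi; split=> u *; [apply: (altphi u).1|apply: (altphi u).2].
Qed.

(** A repeated entry is moved by adjacent exchanges next to its double. *)
Lemma alternating_nonuniq phi s : alternating phi -> ~~ uniq s -> phi s = 0.
Proof.
case=> phiN phi0.
have dup w x v u : phi (u ++ x :: v ++ x :: w) = 0.
  elim: v u => [|y v IH] u /=; first exact: phi0.
  by rewrite phiN -cat_rcons IH oppr0.
have H u : ~~ uniq s -> phi (u ++ s) = 0.
  elim: s u => //= x s IH u; rewrite negb_and negbK => /orP[|/IH]; last first.
    by move/(_ (rcons u x)); rewrite cat_rcons.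
  by case/splitPr => v w; exact: dup.
exact: (H [::]).
Qed.

End Coboundary.

(** * The chains z_k and barycentric subdivision, acting on cochains *)

Lemma cobd_map (F : comNzRingType) (T U : eqType) (f : T -> U)
    (phi : seq U -> F) s :
  cobd (fun t => phi (map f t)) s = cobd phi (map f s).
Proof. by elim: s phi => //= b s IH phi; rewrite (IH (fun t => phi (f b :: t))). Qed.

Section PeriodicOperators.
Variables (F : comNzRingType) (T : eqType) (g : T -> T) (p : nat).
Implicit Types (phi psi : seq T -> F) (s : seq T).

Definition diffop phi s := phi (map g s) - phi s.
Definition normop phi s := \sum_(j < p) phi (map (iter j g) s).
(** The dual of D_k.  These are the differentials of the periodic resolution of
    the cyclic group of order p; D_0 is the identity because z_0 is the empty
    tuple, which generates the augmentation. *)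
Definition periodic_op k phi :=
  if k == 0 then phi else if odd k then diffop phi else normop phi.

Arguments periodic_op : simpl never.

Lemma cobd_periodic_op k phi s : cobd (periodic_op k phi) s = periodic_op k (cobd phi) s.
Proof.
rewrite /periodic_op /diffop /normop; case: (k == 0) => //; case: odd.
  by rewrite cobdB cobd_map.
by rewrite cobd_sum; apply: eq_bigr => j _; rewrite cobd_map.
Qed.

Lemma periodic_opB k phi psi s :
  periodic_op k (fun t => phi t - psi t) s = periodic_op k phi s - periodic_op k psi s.
Proof.
rewrite /periodic_op /diffop /normop; case: (k == 0) => //; case: odd.
  by rewrite opprD addrACA -opprD.
by rewrite sumrB.
Qed.

Lemma periodic_opSS k phi : periodic_op k.+3 phi = periodic_op k.+1 phi.
Proof. by rewrite /periodic_op /= negbK. Qed.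

Lemma periodic_op_eq k phi psi s :
  (forall j, phi (map (iter j g) s) = psi (map (iter j g) s)) ->
  periodic_op k phi s = periodic_op k psi s.
Proof.
move=> eq_ff; have e0 := eq_ff 0; have e1 := eq_ff 1%N.
rewrite /= map_id in e0; rewrite /periodic_op /diffop /normop.
case: (k == 0) => //; case: odd; first by rewrite e0 e1.
exact: eq_bigr.
Qed.

Lemma map_iterS j s : map (iter j g) (map g s) = map (iter j.+1 g) s.
Proof. by rewrite -map_comp; apply: eq_map => x /=; rewrite -iterSr. Qed.

Hypothesis g_order : forall x, iter p g x = x.

Lemma map_iter_order s : map (iter p g) s = s.
Proof. by rewrite (eq_map g_order) map_id. Qed.

Lemma orbit_sum_shift phi s :
  \sum_(j < p) phi (map (iter j.+1 g) s) = \sum_(j < p) phi (map (iter j g) s).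
Proof.
apply/eqP; rewrite -subr_eq0 -sumrB.
rewrite -(big_mkord xpredT (fun j => phi (map (iter j.+1 g) s) - phi (map (iter j g) s))).
by rewrite telescope_sumr // map_iter_order map_id subrr.
Qed.

Lemma periodic_op_exact k phi s : periodic_op k.+1 (periodic_op k.+2 phi) s = 0.
Proof.
rewrite /periodic_op /= negbK /diffop /normop; case: odd => /=.
  rewrite sumrB; apply/eqP; rewrite subr_eq0 -[eqbRHS]orbit_sum_shift.
  by apply/eqP/eq_bigr => j _; rewrite -map_comp.
rewrite -[X in _ - X]orbit_sum_shift -sumrB big1 // => j _.
by rewrite map_iterS subrr.
Qed.

Variable e : nat -> T.

(** Evaluation of cochains on the chain z_k of tuples with k entries, which is
    defined by z_0 = [::] and z_(k+1) = cone from e_k over D_k z_k. *)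
Fixpoint chain_eval k phi : F :=
  if k is k'.+1 then chain_eval k' (periodic_op k' (fun s => phi (e k' :: s)))
  else phi [::].

Lemma chain_evalB k phi psi :
  chain_eval k (fun t => phi t - psi t) = chain_eval k phi - chain_eval k psi.
Proof.
elim: k phi psi => //= k IH phi psi.
by rewrite -IH; congr chain_eval; apply/funext => s; rewrite periodic_opB.
Qed.

Lemma chain_eval0 k : chain_eval k (fun=> 0) = 0.
Proof.
by have := chain_evalB k (fun=> 0) (fun=> 0); rewrite !subrr. Qed.

(** The boundary of the cone over D_k z_k is D_k z_k minus the cone over its
    boundary D_k D_(k-1) z_(k-1), which is zero. *)
Lemma chain_eval_cobd k phi : chain_eval k.+1 (cobd phi) = chain_eval k (periodic_op k phi).
Proof.
elim: k phi => [|k IH] phi; first by rewrite /= /periodic_op /= subr0.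
pose phi_e t := phi (e k.+1 :: t).
have -> : chain_eval k.+2 (cobd phi) =
    chain_eval k.+1 (fun s => periodic_op k.+1 phi s - cobd (periodic_op k.+1 phi_e) s).
  rewrite -[LHS]/(chain_eval k.+1 (periodic_op k.+1 (fun s => phi s - cobd phi_e s))).
  by congr chain_eval; apply/funext => s; rewrite cobd_periodic_op -periodic_opB.
rewrite chain_evalB IH.
rewrite (_ : chain_eval k _ = 0) ?subr0 //.
case: k {IH} @phi_e => [|k] phi_e; first by rewrite /= /periodic_op /= /diffop subrr.
by rewrite -(chain_eval0 k.+1); congr chain_eval; apply/funext => s; rewrite periodic_op_exact.
Qed.

End PeriodicOperators.

Section Subdivision.
Variables (F : comNzRingType) (T : eqType) (bary : seq T -> T).
Implicit Types (phi psi : seq T -> F) (s : seq T).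

(** Dual of barycentric subdivision: a tuple is replaced by the cone from its
    barycenter over the subdivided boundary.  The parameter k is the number of
    entries, and it serves as the recursion bound. *)
Fixpoint subdiv k phi s : F :=
  if k is k'.+1 then cobd (subdiv k' (fun t => phi (bary s :: t))) s
  else phi s.

Lemma subdivB k phi psi s :
  subdiv k (fun t => phi t - psi t) s = subdiv k phi s - subdiv k psi s.
Proof.
elim: k phi psi s => //= k IH phi psi s.
by rewrite -cobdB; congr cobd; apply/funext => t; rewrite IH.
Qed.

(** Subdivision is a chain map: the boundary of the cone over a subdivided
    boundary is that subdivided boundary, which is itself a cycle. *)
Lemma subdiv_cobd k phi s : subdiv k.+1 (cobd phi) s = cobd (subdiv k phi) s.
Proof.
elim: k phi s => [|k IH] phi s; first by rewrite /= cobdB cobd_cobd subr0.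
pose phi_b t := phi (bary s :: t).
rewrite -[LHS]/(cobd (subdiv k.+1 (fun t => phi t - cobd phi_b t)) s).
rewrite (_ : subdiv k.+1 _ = fun t => subdiv k.+1 phi t - cobd (subdiv k phi_b) t).
  by rewrite cobdB cobd_cobd subr0.
by apply/funext => t; rewrite -IH -subdivB.
Qed.

Lemma iter_subdiv_cobd m k phi :
  iter m (subdiv k.+1) (cobd phi) = cobd (iter m (subdiv k) phi).
Proof.
by elim: m => [|m IH] //; rewrite !iterS IH; apply/funext => s; rewrite subdiv_cobd.
Qed.

Lemma subdiv_sum n k (phi : 'I_n -> seq T -> F) s :
  subdiv k (fun t => \sum_(j < n) phi j t) s = \sum_(j < n) subdiv k (phi j) s.
Proof.
elim: k phi s => //= k IH phi s.
by rewrite -cobd_sum; congr cobd; apply/funext => t; rewrite IH.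
Qed.

Lemma subdiv_map (f : T -> T) k phi s :
  (forall s, bary (map f s) = f (bary s)) ->
  subdiv k (fun t => phi (map f t)) s = subdiv k phi (map f s).
Proof.
move=> fbary; elim: k phi s => //= k IH phi s.
rewrite -cobd_map fbary; congr cobd; apply/funext => t.
exact: (IH (fun u => phi (f (bary s) :: u))).
Qed.

Variables (g : T -> T) (p : nat).
Hypothesis bary_g : forall s, bary (map g s) = g (bary s).

Lemma bary_iter j s : bary (map (iter j g) s) = iter j g (bary s).
Proof.
elim: j => [|j IH] /=; first by rewrite map_id.
by rewrite -IH -bary_g -map_comp.
Qed.

Lemma subdiv_periodic_op k i phi s :
  subdiv k (periodic_op g p i phi) s = periodic_op g p i (subdiv k phi) s.
Proof.
rewrite /periodic_op /diffop /normop; case: (i == 0) => //; case: odd.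
  by rewrite subdivB subdiv_map.
by rewrite subdiv_sum; apply: eq_bigr => j _; rewrite subdiv_map //; exact: bary_iter.
Qed.

Lemma iter_subdiv_periodic_op m k i phi :
  iter m (subdiv k) (periodic_op g p i phi) = periodic_op g p i (iter m (subdiv k) phi).
Proof.
by elim: m => //= m ->; apply/funext => s; rewrite subdiv_periodic_op.
Qed.

End Subdivision.

(** * Obstruction cochains on labels of a free cyclic action *)

Section Labels.
Variables (L : eqType) (g : L -> L) (p n : nat) (col expo : L -> nat).
Hypothesis p_gt0 : (0 < p)%N.
Hypothesis g_order : forall x, iter p g x = x.
Hypothesis col_lt : forall x, (col x < n)%N.
Hypothesis col_g : forall x, col (g x) = col x.
Hypothesis expo_lt : forall x, (expo x < p)%N.
Hypothesis expo_g : forall x, expo (g x) = ((expo x).+1 %% p)%N.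

(** The combinatorial trace of smallness: the labels of points that are close to
    each other satisfy this, and it bounds the number of distinct labels by the
    number of colours. *)
Definition compatible (s : seq L) :=
  forall x y, x \in s -> y \in s -> col x = col y -> x = y.

Lemma col_iter j x : col (iter j g x) = col x.
Proof. by elim: j => //= j; rewrite col_g. Qed.

Lemma compatible_sub s t : {subset t <= s} -> compatible s -> compatible t.
Proof. by move=> ts cs x y /ts xs /ts ys; exact: cs. Qed.

Lemma compatible_map j s : compatible s -> compatible (map (iter j g) s).
Proof.
move=> cs _ _ /mapP[x xs ->] /mapP[y ys ->]; rewrite !col_iter => cxy.
by rewrite (cs x y).
Qed.

Lemma compatible_nonuniq s : compatible s -> (n < size s)%N -> ~~ uniq s.
Proof.
move=> cs; apply: contraTN => us; rewrite -leqNgt -(size_map col).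
rewrite -[leqRHS](size_iota 0); apply: uniq_leq_size.
  by rewrite map_inj_in_uniq // => x y xs ys; exact: cs.
by move=> _ /mapP[x _ ->]; rewrite mem_iota /=.
Qed.

(** The colour is the high-order digit, so that minimal keys first compare
    colours. *)
Definition key x := (col x * p + expo x)%N.

Definition minkey s := foldr (fun x => minn (key x)) (n * p)%N s.

(** The exponent of the entry of lowest colour.  It is defined for all tuples
    and does not depend on the order of the entries, so that solving equations
    with it keeps cochains alternating; on compatible tuples it is equivariant
    ([phase_g]), and thus trivializes the free action on them. *)
Definition phase s := (minkey s %% p)%N.

Lemma key_lt x : (key x < n * p)%N.
Proof. by rewrite /key; have := col_lt x; have := expo_lt x; nia. Qed.

Lemma phase_lt s : (phase s < p)%N.
Proof. by rewrite ltn_mod. Qed.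

Lemma phase_swap u x y v : phase (u ++ x :: y :: v) = phase (u ++ y :: x :: v).
Proof.
by rewrite /phase /minkey !foldr_cat /= minnCA.
Qed.

Lemma minkey_le s x : x \in s -> (minkey s <= key x)%N.
Proof.
elim: s => //= y s IH; rewrite inE => /orP[/eqP ->|/IH]; first exact: geq_minl.
by apply: leq_trans; exact: geq_minr.
Qed.

Lemma minkey_mem s : s != [::] -> exists2 x, x \in s & minkey s = key x.
Proof.
elim: s => // x [_ _|y s IH _].
  by exists x; rewrite ?mem_head //= /minn key_lt.
have [//|z zs ez] := IH.
rewrite -[minkey _]/(minn (key x) (minkey (y :: s))) ez /minn.
by case: ifP => _; [exists x; rewrite ?mem_head|exists z; rewrite // inE zs orbT].
Qed.

(** In a compatible tuple the entry of lowest colour is unique, and colours are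
    invariant, so its image is the entry of lowest colour of the image. *)
Lemma phase_g s : compatible s -> s != [::] ->
  phase (map g s) = ((phase s).+1 %% p)%N.
Proof.
move=> cs s0; have [x xs ex] := minkey_mem s0.
have ms0 : map g s != [::] by case: s s0 {cs xs ex}.
have [_ /mapP[y ys ->] ey] := minkey_mem ms0.
have h1 := minkey_le ys; have h2 := minkey_le (map_f g xs).
have cxy : col x = col y.
  move: h1 h2; rewrite ex ey /key !col_g => h1 h2.
  have := expo_lt (g x); have := expo_lt (g y); have := expo_lt x.
  have := expo_lt y; nia.
have exy := cs _ _ xs ys cxy; rewrite -exy in ey.
by rewrite /phase ex ey /key col_g !modnMDl expo_g modn_mod (modn_small (expo_lt x)).
Qed.

Lemma phase_iter j s : compatible s -> s != [::] ->
  phase (map (iter j g) s) = ((phase s + j) %% p)%N.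
Proof.
move=> cs s0; elim: j => [|j IH]; first by rewrite map_id addn0 modn_small ?phase_lt.
have -> : map (iter j.+1 g) s = map g (map (iter j g) s) by rewrite -map_comp.
rewrite phase_g ?IH; [|exact: compatible_map|by case: s s0 {cs IH}].
by rewrite -[in LHS]addn1 modnDml addn1 addnS.
Qed.

Variable F : comNzRingType.
Implicit Types phi : seq L -> F.

(** A contraction of the periodic complex on the orbit of s, which [phase]
    identifies with the cyclic group: s lies phase s steps after the base point
    of its orbit.  For D_k = g - 1 the values of phi are summed from the base
    point up to the predecessor of s; for the norm, phi is concentrated at the base point. *)
Definition periodic_solve k phi s : F :=
  if odd k then \sum_(j < phase s) phi (map (iter (p - phase s + j) g) s)
  else if phase s == 0%N then phi s else 0.

Lemma alternating_periodic_solve k phi : alternating phi -> alternating (periodic_solve k phi).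
Proof.
case=> phiN phi0; rewrite /periodic_solve; split=> [u x y v|u x v]; case: odd.
- rewrite phase_swap -sumrN; apply: eq_bigr => j _.
  by rewrite !map_cat /= phiN.
- by rewrite phase_swap; case: ifP => _; [exact: phiN|rewrite oppr0].
- by rewrite big1 // => j _; rewrite map_cat /= phi0.
- by rewrite phi0 if_same.
Qed.

(** Exactness of the cochains of a free action: D_k D_(k+1) = 0, and a solution
    of D_(k+1) phi = 0 is in the image of D_k. *)
Lemma periodic_op_solve k phi m :
  (forall s, compatible s -> size s = m.+1 -> periodic_op g p k.+2 phi s = 0) ->
  forall s, compatible s -> size s = m.+1 ->
  periodic_op g p k.+1 (periodic_solve k.+1 phi) s = phi s.
Proof.
rewrite /periodic_op /periodic_solve /= negbK => phi0 s cs sz.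
have s0 : s != [::] by rewrite -size_eq0 sz.
case: (boolP (odd k)) phi0 => kodd phi0 /=.
  have phi_iter j : phi (map (iter j g) s) = phi s.
    elim: j => [|j IH]; first by rewrite map_id.
    rewrite -[RHS]IH; apply/eqP; rewrite -subr_eq0 -[X in _ == X](phi0 (map (iter j g) s)).
    - by rewrite /diffop -map_comp.
    - exact: compatible_map.
    - by rewrite size_map.
  rewrite /normop; under eq_bigr do rewrite phase_iter // phi_iter.
  have q_lt : ((p - phase s) %% p < p)%N by rewrite ltn_mod.
  rewrite (bigD1 (Ordinal q_lt)) //= modnDmr subnKC ?(ltnW (phase_lt s)) // modnn eqxx.
  rewrite big1 ?addr0 // => j /eqP jq; case: eqP => // /eqP e; case: jq; apply/val_inj => /=.
  have := phase_lt s; have := ltn_ord j => jp qp.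
  move: e; rewrite -/(dvdn _ _) => /dvdnP[d e].
  have [q0|q0] := posnP (phase s).
    rewrite q0 subn0 modnn; case: d e => [|d]; lia.
  rewrite modn_small; last by lia.
  case: d e => [|[|d]]; lia.
rewrite /diffop; have qp := phase_lt s.
rewrite phase_g //.
have [qp1|qp1] := ltnP (phase s).+1 p.
  rewrite modn_small // big_ord_recr /= addrAC.
  rewrite [X in _ + X](_ : _ = phi s); last first.
    by rewrite map_iterS -addSn subnSK // subnK ?(ltnW qp) // map_iter_order.
  rewrite -sumrB big1 ?add0r // => j _.
  by rewrite map_iterS -addSn subnSK // subrr.
have pq : p = (phase s).+1 by apply/eqP; rewrite eqn_leq qp1 qp.
have := phi0 s cs sz; rewrite /normop pq big_ord_recl /= map_id => phis.
rewrite -pq modnn big_ord0 sub0r; apply/eqP.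
rewrite eq_sym -addr_eq0 -[eqbRHS]phis; apply/eqP; congr (_ + _).
apply: eq_bigr => j _; congr (phi (map (iter _ g) s)).
by rewrite [in LHS]pq subSnn.
Qed.

(** The cochains psi_k.  The first one is the augmentation; the others solve
    D_(k+1) psi_(k+1) = coboundary(psi_k). *)
Fixpoint obstruction k : seq L -> F :=
  if k is k'.+1 then periodic_solve k'.+1 (cobd (obstruction k'))
  else fun s => (s == [::])%:R.

Lemma alternating_obstruction k : alternating (obstruction k).
Proof.
elim: k => [|k IH]; last exact/alternating_periodic_solve/alternating_cobd.
by split=> [u x y v|u x v]; case: u; rewrite //= oppr0.
Qed.

Hypothesis charF : p%:R = 0 :> F.

(** The equation for psi_(k+2) is solvable since D_(k+1) applied to the
    coboundary of psi_(k+1) is the coboundary of the coboundary of psi_k.  For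
    psi_1 the condition is that the norm of the constant 1 is p = 0. *)
Lemma periodic_op_obstruction k s : compatible s -> size s = k.+1 ->
  periodic_op g p k.+1 (obstruction k.+1) s = cobd (obstruction k) s.
Proof.
move: s; apply: periodic_op_solve; elim: k => [|k IH] s cs sz.
  case: s sz {cs} => [|x []] //= _.
  rewrite /periodic_op /= /normop /= -[RHS]charF -[in RHS](card_ord p) -sumr_const.
  by apply: eq_bigr => j _; rewrite subr0.
rewrite periodic_opSS -cobd_periodic_op -[RHS](cobd_cobd (obstruction k) s).
apply: cobd_face => t /mem_subseq ts szt; apply: (periodic_op_solve IH).
  exact: compatible_sub cs.
by move: szt; rewrite sz => -[].
Qed.

Lemma obstruction_vanish k s :
  compatible s -> size s = k -> (n < k)%N -> obstruction k s = 0.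
Proof.
move=> cs sz nk; apply: (alternating_nonuniq (alternating_obstruction k)).
by apply: compatible_nonuniq => //; rewrite sz.
Qed.

End Labels.

(** The combinatorial core: points with an action of order p and equivariant
    barycenters cannot be labelled equivariantly with n colours if, on the
    subdivided chains z_k for k <= n + 1, the labels are compatible.  The
    predicate good stands for the small tuples, on which alone the labelling is
    under control. *)
Section NoLabelling.
Variables (F : comNzRingType) (p n : nat).
Hypotheses (p_gt0 : (0 < p)%N) (charF : p%:R = 0 :> F).
Variables (P : eqType) (gP : P -> P) (bary : seq P -> P) (e : nat -> P).
Hypothesis gP_order : forall x, iter p gP x = x.
Hypothesis bary_g : forall s, bary (map gP s) = gP (bary s).
Variables (L : eqType) (g : L -> L) (col expo : L -> nat).
Hypothesis g_order : forall x, iter p g x = x.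
Hypothesis col_lt : forall x, (col x < n)%N.
Hypothesis col_g : forall x, col (g x) = col x.
Hypothesis expo_lt : forall x, (expo x < p)%N.
Hypothesis expo_g : forall x, expo (g x) = ((expo x).+1 %% p)%N.
Variables (lab : P -> L) (good : seq P -> Prop) (m : nat).
Hypothesis good_lab : forall s x, good s -> x \in s ->
  lab (gP x) = g (lab x).
Hypothesis good_g : forall s, good s -> good (map gP s).
Hypothesis good_compatible : forall s, good s -> compatible col (map lab s).
Hypothesis good_support : forall k (phi psi : seq P -> F), (k <= n.+1)%N ->
  (forall s, good s -> size s = k -> phi s = psi s) ->
  chain_eval gP p e k (iter m (subdiv bary k) phi) =
  chain_eval gP p e k (iter m (subdiv bary k) psi).

Lemma good_iter s : good s -> forall j, good (map (iter j gP) s).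
Proof.
move=> gs; elim=> [|j IH]; first by rewrite map_id.
have -> : map (iter j.+1 gP) s = map gP (map (iter j gP) s) by rewrite -map_comp.
exact: good_g.
Qed.

Lemma good_lab_iter s : good s -> forall j,
  map lab (map (iter j gP) s) = map (iter j g) (map lab s).
Proof.
move=> gs j; rewrite -!map_comp; apply/eq_in_map => x xs /=.
elim: j => //= j <-; apply: (good_lab (good_iter gs j)).
exact: map_f.
Qed.

(** Q k is the number <D_k psi_k, z_k> of the introduction, for the psi_k pulled
    back to the m-fold subdivision. *)
Theorem no_good_labelling : False.
Proof.
pose psi k := obstruction g p n col expo F k.
pose Q k := chain_eval gP p e k
  (iter m (subdiv bary k) (fun s => periodic_op g p k (psi k) (map lab s))).
have Q0 : Q 0%N = 1.
  rewrite /Q /= (_ : iter _ _ _ = fun s => periodic_op g p 0 (psi 0%N) (map lab s)) //.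
  by elim: {Q} m => //= j ->.
have QS k : (k <= n)%N -> Q k.+1 = Q k.
  move=> kn; rewrite /Q.
  rewrite (good_support (psi := cobd (fun s => psi k (map lab s)))) //; last first.
    move=> s gs sz; rewrite cobd_map.
    apply: (periodic_op_obstruction p_gt0 g_order) => //; first exact: good_compatible.
    by rewrite size_map.
  rewrite iter_subdiv_cobd chain_eval_cobd // -(iter_subdiv_periodic_op p bary_g).
  apply: good_support => [|s gs _]; first exact: leqW.
  have labE := good_lab_iter gs.
  have labE1 : map lab (map gP s) = map g (map lab s) := labE 1%N.
  rewrite /periodic_op /diffop /normop; case: (k == 0)%N => //.
  case: odd; first by rewrite labE1.
  by apply: eq_bigr => j _; rewrite labE.
have Qn : Q n.+1 = 0.
  rewrite /Q (good_support (psi := fun=> 0)) //; last first.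
    move=> s gs sz; rewrite (@periodic_op_eq _ _ _ _ _ _ (fun=> 0)).
      by rewrite /periodic_op /diffop /normop big1 // subrr !if_same.
    move=> j; rewrite -good_lab_iter // /psi.
    apply: obstruction_vanish => //; last by rewrite !size_map.
    exact/good_compatible/good_iter.
  rewrite -[RHS](chain_eval0 F gP p e n.+1); congr chain_eval.
  elim: {Q Q0 QS} m => // j IH; rewrite iterS IH; apply/funext => s.
  by have := subdivB bary n.+1 (fun=> 0 : F) (fun=> 0) s; rewrite !subrr.
have : Q n.+1 = 1.
  have H k : (k <= n.+1)%N -> Q k = 1.
    elim: k => // k IH kn; rewrite QS //; exact/IH/ltnW.
  exact: H.
by rewrite Qn => /esym/eqP; rewrite oner_eq0.
Qed.

End NoLabelling.

(** * Support and mesh of iterated subdivisions *)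

Section ChainSupport.
Variables (F : comNzRingType) (T : eqType) (g : T -> T) (p : nat) (e : nat -> T).

(** Evaluation on z_k is local: W k only has to contain the tuples that occur in
    z_k, which arise from e_0, e_1, ... by rotating and coning off. *)
Lemma chain_eval_support (W : nat -> seq T -> Prop) k (phi psi : seq T -> F) :
  W 0 [::] -> (forall i s j, W i s -> W i.+1 (e i :: map (iter j g) s)) ->
  (forall s, W k s -> phi s = psi s) ->
  chain_eval g p e k phi = chain_eval g p e k psi.
Proof.
move=> W0 WS; elim: k phi psi => [|k IH] phi psi eq_ff /=; first exact: eq_ff.
apply: IH => s Ws; apply: periodic_op_eq => j; apply: eq_ff; exact: WS.
Qed.

End ChainSupport.

Section Barycenter.
Variables (R : realFieldType) (V : finType).
Implicit Types (x y : V -> R) (s : seq (V -> R)).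

Definition bary s : V -> R := fun v => (\sum_(x <- s) x v) / (size s)%:R.

Definition dist_le d x y := forall v, `|x v - y v| <= d.

(** Closure under barycenters of tuples is the only form of convexity that
    barycentric subdivision uses. *)
Definition convex (C : (V -> R) -> Prop) :=
  forall s, s != [::] -> (forall x, x \in s -> C x) -> C (bary s).

Lemma bary_push (f : V -> V) s :
  bary (map (fun x => x \o f) s) = bary s \o f.
Proof. by apply/funext => v; rewrite /bary big_map size_map. Qed.

Lemma dist_le_sym d x y : dist_le d x y -> dist_le d y x.
Proof. by move=> xy v; rewrite distrC. Qed.

Lemma bary_sub s (c : R) v : s != [::] ->
  bary s v - c = (\sum_(x <- s) (x v - c)) / (size s)%:R.
Proof.
rewrite -size_eq0 => s0; have s0' : (size s)%:R != 0 :> R by rewrite pnatr_eq0.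
apply: (mulIf s0'); rewrite mulrBl !divfK // mulr_natr.
elim: s {s0 s0'} => [|x s IH]; first by rewrite !big_nil subr0.
by rewrite !big_cons -IH mulrS opprD addrACA.
Qed.

Lemma ler_sum_dist s (c d : R) v :
  (forall x, x \in s -> `|x v - c| <= d) ->
  `|\sum_(x <- s) (x v - c)| <= d *+ size s.
Proof.
elim: s => [|x s IH] sd; first by rewrite big_nil normr0.
rewrite big_cons mulrS (le_trans (ler_normD _ _)) // lerD ?sd ?mem_head //.
by apply: IH => y ys; apply: sd; rewrite inE ys orbT.
Qed.

Lemma convex_dist_le d y : convex (dist_le d y).
Proof.
move=> s s0 sd v; rewrite distrC bary_sub // normrM normfV normr_nat.
rewrite ler_pdivrMr ?ltr0n ?lt0n ?size_eq0 // mulr_natr.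
by apply: ler_sum_dist => x /sd; rewrite distrC.
Qed.

(** In the average of the differences y - x one of the at most n + 1 terms is
    zero; this is the factor by which subdivision shrinks the mesh. *)
Lemma dist_le_bary_vertex n d s x : 0 <= d -> x \in s -> (size s <= n.+1)%N ->
  (forall y, y \in s -> dist_le d y x) ->
  dist_le (n%:R / n.+1%:R * d) (bary s) x.
Proof.
move=> d0 xs sn sd v; have s0 : s != [::] by case: s xs {sn sd}.
rewrite bary_sub // (perm_big _ (perm_to_rem xs)) /= big_cons subrr add0r.
rewrite normrM normfV normr_nat.
have ss : size s = (size (rem x s)).+1 by rewrite (perm_size (perm_to_rem xs)).
rewrite ler_pdivrMr ?ltr0n ?lt0n ?size_eq0 //.
apply: (@le_trans _ _ (d *+ size (rem x s))).
  by apply: ler_sum_dist => y /mem_rem ys; exact: sd.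
rewrite ss in sn *; move: (size (rem x s)) sn => k kn {ss}.
rewrite -[leLHS]mulr_natr [_ * d]mulrC -[leRHS]mulrA ler_wpM2l //.
rewrite mulrAC ler_pdivlMr ?ltr0n // -!natrM ler_nat; nia.
Qed.

Variable F : comNzRingType.
Implicit Types phi psi : seq (V -> R) -> F.

(** The simplices of the subdivision of s are cones from the barycenter b over
    simplices t in the subdivision of a face.  Adding to C the condition of
    being close to b, which is again convex and holds at the vertices of s, the
    induction hypothesis for the face bounds the distances from b to t too. *)
Lemma subdiv_support n k phi psi s d C :
  0 <= d -> convex C -> size s = k -> (k <= n.+1)%N ->
  (forall x, x \in s -> C x) ->
  (forall x y, x \in s -> y \in s -> dist_le d x y) ->
  (forall t, size t = k -> (forall x, x \in t -> C x) ->
     (forall x y, x \in t -> y \in t -> dist_le (n%:R / n.+1%:R * d) x y) ->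
     phi t = psi t) ->
  subdiv bary k phi s = subdiv bary k psi s.
Proof.
move=> d0; elim: k s C phi psi => [|k IH] s C phi psi convC sz kn sC sd eq_ff /=.
  by apply: eq_ff => //; case: s sz {sC sd}.
have s0 : s != [::] by rewrite -size_eq0 sz.
have d0' : 0 <= n%:R / n.+1%:R * d by rewrite mulr_ge0 // divr_ge0.
apply: cobd_face => t /mem_subseq ts; rewrite sz => -[szt].
apply: (IH t (fun x => C x /\ dist_le (n%:R / n.+1%:R * d) (bary s) x)) => //.
- move=> u u0 uC; split; first by apply: convC => // x /uC[].
  by apply: convex_dist_le => // x /uC[].
- exact: ltnW.
- move=> x /ts xs; split; first exact: sC.
  by apply: dist_le_bary_vertex => //; [rewrite sz|move=> y ys; exact: sd].
- by move=> x y /ts xs /ts ys; exact: sd.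
move=> u szu uC ud; apply: eq_ff; first by rewrite /= szu.
- by move=> x; rewrite inE => /orP[/eqP ->|/uC[]//]; exact: convC.
move=> x y; rewrite !inE => /orP[/eqP ->|xu] /orP[/eqP ->|yu].
- by move=> v; rewrite subrr normr0.
- by have [] := uC y yu.
- by apply: dist_le_sym; have [] := uC x xu.
- exact: ud.
Qed.

Lemma iter_subdiv_support n m k phi psi s d C :
  0 <= d -> convex C -> size s = k -> (k <= n.+1)%N ->
  (forall x, x \in s -> C x) ->
  (forall x y, x \in s -> y \in s -> dist_le d x y) ->
  (forall t, size t = k -> (forall x, x \in t -> C x) ->
     (forall x y, x \in t -> y \in t -> dist_le ((n%:R / n.+1%:R) ^+ m * d) x y) ->
     phi t = psi t) ->
  iter m (subdiv bary k) phi s = iter m (subdiv bary k) psi s.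
Proof.
move=> d0 convC sz kn; elim: m s d d0 sz => [|m IH] s d d0 sz sC sd eq_ff.
  by apply: eq_ff => //; rewrite expr0 mul1r.
rewrite !iterS; apply: (subdiv_support d0 convC sz kn sC sd) => t szt tC td.
apply: (IH _ _ _ szt tC td); first by rewrite mulr_ge0 // divr_ge0.
by move=> u szu uC ud; apply: eq_ff; rewrite // exprSr -mulrA.
Qed.

End Barycenter.

(** * Compactness and convexity of finite complexes *)

Section Topology.
Variable R : realType.

Lemma continuous_sum (T : topologicalType) I (r : seq I) (f : I -> T -> R) :
  (forall i, continuous (f i)) -> continuous (fun y => \sum_(i <- r) f i y).
Proof.
move=> cf; elim: r => [|i r IH].
  rewrite (_ : (fun _ => _) = fun=> 0); first exact: cst_continuous.
  by apply/funext => y; rewrite big_nil.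
rewrite (_ : (fun _ => _) = fun y => f i y + \sum_(j <- r) f j y).
  by move=> x; apply: continuousD; [exact: cf|exact: IH].
by apply/funext => y; rewrite big_cons.
Qed.

Lemma continuous_prod (T : topologicalType) I (r : seq I) (P : pred I)
    (f : I -> T -> R) :
  (forall i, continuous (f i)) -> continuous (fun y => \prod_(i <- r | P i) f i y).
Proof.
move=> cf; elim: r => [|i r IH].
  rewrite (_ : (fun _ => _) = fun=> 1); first exact: cst_continuous.
  by apply/funext => y; rewrite big_nil.
pose g y := \prod_(j <- r | P j) f j y.
rewrite (_ : (fun _ => _) = if P i then fun y => f i y * g y else g).
  by case: (P i) => // x; exact: (continuousM (cf i x) (IH x)).
by apply/funext => y; rewrite big_cons; case: (P i).
Qed.

(** A cluster point in A of the image filter is a cluster point of the filter,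
    since the topology of the subtype is induced. *)
Lemma compact_set_type (T : topologicalType) (A : set T) :
  compact A -> compact [set: A].
Proof.
move=> cA F PF _.
have FA : (set_val @ F) A.
  by apply: (@filterS _ F _ setT) => [y _|]; [have := set_valP y|exact: filterT].
have [x [Ax clx]] := cA _ (fmap_proper_filter set_val PF) FA.
have Ax' : x \in A by exact: mem_set.
exists (exist _ x Ax' : A); split=> // B U FB [W [[W' oW' <-] W'x] WU].
have FB' : (set_val @ F) (set_val @` B).
  by apply: (@filterS _ F _ B) => // b Bb; exists b.
have nW' : nbhs x W' by apply: open_nbhs_nbhs; split.
have [_ [[b Bb <-] W'y]] := clx _ _ FB' nW'.
by exists b; split=> //; exact: WU.
Qed.

End Topology.

Section Geometry.
Variables (R : realType) (gT : finGroupType) (K : gcomplex gT).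
Local Notation X := (geom R K).

Lemma ptws_coord_continuous v :
  continuous (fun x : {ptws gvert K -> R} => x v).
Proof. exact: (@proj_continuous (gvert K) (fun=> R)). Qed.

Lemma geom_coord_continuous v : continuous (fun x : X => set_val x v).
Proof.
move=> x; apply: (@continuous_comp _ _ _ (set_val : X -> {ptws gvert K -> R})
  (fun y : {ptws gvert K -> R} => y v)); last exact: ptws_coord_continuous.
exact: initial_continuous.
Qed.

(** The condition on supports is closed: as faces are closed under nonempty
    subsets, it says that the product of the coordinates over each nonempty
    non-face is zero. *)
Lemma geom_set_closed : closed (@geom_set R gT K).
Proof.
pose P (s : {set gvert K}) := s \notin gface K.
have -> : @geom_set R gT K =
    (\bigcap_v (fun x : {ptws gvert K -> R} => x v) @^-1` [set a | 0 <= a]) `&`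
    ((fun x : {ptws gvert K -> R} => \sum_v x v) @^-1` [set a | a = 1]) `&`
    (\bigcap_(s in [set s | P s]) 
       (fun x : {ptws gvert K -> R} => if s == finset.set0 then 0 else \prod_(v in s) x v)
          @^-1` [set a | a = 0]).
  rewrite eqEsubset; split=> x.
    case=> x0 x1 xK; split; [by split=> // v _; exact: x0|move=> s /= sK].
    case: eqP => // /eqP s0; apply/eqP; apply: contraNT sK => xs.
    apply: (gface_sub xK) => //; apply/fintype.subsetP => v vs; rewrite inE.
    by apply: contraNneq xs => xv; rewrite (bigD1 v) //= xv mul0r.
  case=> -[x0 /= x1] xK; split=> //; first by move=> v; exact: x0.
  apply: contrapT => /negP /[dup] sK /xK /=; case: eqP => [s0 _|_ /eqP].
    move: x1; rewrite big1 => [/esym/eqP|v _]; first by rewrite oner_eq0.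
    apply/eqP; apply: contraPT s0 => xv /setP /(_ v).
    by rewrite !inE xv.
  by apply/negP/prodf_neq0 => v; rewrite inE.
apply: closedI; first apply: closedI.
- apply: closed_bigI => v _.
  by apply: (iffLR (continuous_closedP _)); [exact: ptws_coord_continuous|exact: closed_ge].
- apply: (iffLR (continuous_closedP _)); last exact: closed_eq.
  by apply: continuous_sum => v; exact: ptws_coord_continuous.
apply: closed_bigI => s _; apply: (iffLR (continuous_closedP _)); last exact: closed_eq.
case: eqP => _; first exact: cst_continuous.
by apply: continuous_prod => v; exact: ptws_coord_continuous.
Qed.

Lemma geom_compact : compact [set: X].
Proof.
apply: compact_set_type.
have cube : compact [set x : {ptws gvert K -> R} | forall v, `[0, 1]%classic (x v)].
  exact: (@tychonoff (gvert K) (fun=> R) (fun=> `[0, 1]%classic)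
    (fun=> @segment_compact _ 0 1)).
apply: (subclosed_compact geom_set_closed cube).
move=> x [x0 x1 _] v /=; rewrite in_itv /= x0 /= -x1 (bigD1 v) //= lerDl.
by apply: sumr_ge0.
Qed.

(** Heine-Cantor by a covering of X x X.  Near a diagonal point the values of u
    are close; near another point some coordinate separates, and nothing is to
    be shown for small d. *)
Lemma geom_uniform_continuous (u : X -> R) : continuous u -> forall eps : R, 0 < eps ->
  \forall d \near 0^'+, forall x y : X,
    dist_le d (set_val x) (set_val y) -> `|u x - u y| < eps.
Proof.
move=> cu eps eps0.
pose P (d : R) (xy : X * X) := dist_le d (set_val xy.1) (set_val xy.2) ->
  `|u xy.1 - u xy.2| < eps.
have coordD v : continuous (fun xy : X * X => set_val xy.1 v - set_val xy.2 v).
  move=> xy; apply: cvgB.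
    by apply: (@continuous_comp _ _ _ fst (fun x : X => set_val x v));
      [exact: cvg_fst|exact: geom_coord_continuous].
  by apply: (@continuous_comp _ _ _ snd (fun x : X => set_val x v));
    [exact: cvg_snd|exact: geom_coord_continuous].
have uD : continuous (fun xy : X * X => u xy.1 - u xy.2).
  move=> xy; apply: cvgB.
    by apply: (@continuous_comp _ _ _ fst u); [exact: cvg_fst|exact: cu].
  by apply: (@continuous_comp _ _ _ snd u); [exact: cvg_snd|exact: cu].
have cover : \forall d \near 0^'+, [set: X] `*` [set: X] `<=` P d.
  have [+ _] := compact_near_coveringP ([set: X] `*` [set: X]).
  move=> /(_ (compact_setX geom_compact geom_compact)); apply=> -[x y] _.
  have [xy|/eqP xy] := eqVneq x y.
    rewrite -{}xy.
    have near_u : \forall xy \near (x, x), `|u xy.1 - u xy.2| < eps.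
      by have /cvgr_norm_lt := uD (x, x); rewrite /= subrr normr0; exact.
    by exists ([set xy | `|u xy.1 - u xy.2| < eps], setT);
      [split; [exact: near_u|exact: filterT]|case=> z d [zu _] _].
  have [v xyv] : exists v, set_val x v != set_val y v.
    apply: contrapT => /forallNP H; apply: xy; apply/val_inj/funext => v.
    by apply/eqP; have /negP := H v; rewrite negbK.
  have xyv0 : 0 < `|set_val x v - set_val y v| by rewrite normr_gt0 subr_eq0.
  have near_v : \forall xy \near (x, y),
      `|set_val x v - set_val y v| / 2 < `|set_val xy.1 v - set_val xy.2 v|.
    have /cvgr_norm_gt := coordD v (x, y); apply => /=.
    by rewrite ltr_pdivrMr // ltr_pMr // ltr1n.
  exists ([set xy | `|set_val x v - set_val y v| / 2 <
              `|set_val xy.1 v - set_val xy.2 v|],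
          [set d | d < `|set_val x v - set_val y v| / 2]).
    by split; [exact: near_v|apply: nbhs_right_lt; rewrite divr_gt0].
  case=> z d [/= zv dv] /(_ v); rewrite leNgt => /negP; case.
  exact: lt_trans zv.
by apply: filterS cover => d Pd x y; exact: (Pd (x, y)).
Qed.

Lemma exp_ratio_small n (d : R) : 0 < d -> exists m, (n%:R / n.+1%:R) ^+ m < d.
Proof.
move=> d0; have : `|n%:R / n.+1%:R : R| < 1.
  by rewrite ger0_norm ?divr_ge0 // ltr_pdivrMr ?ltr0n // mul1r ltr_nat.
move=> /cvg_expr /cvgrPdist_lt /(_ _ d0) [m _ /(_ m (leqnn m)) /=].
rewrite sub0r normrN ger0_norm ?exprn_ge0 ?divr_ge0 //; by exists m.
Qed.

Section Hull.
Implicit Types (s : {set gvert K}) (x : gvert K -> R).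

(** The closed simplex with vertex set s. *)
Definition hull s x :=
  [/\ forall v, 0 <= x v, \sum_v x v = 1 & forall v, x v != 0 -> v \in s].

Lemma hull_geom s x : s \in gface K -> hull s x -> x \in @geom_set R gT K.
Proof.
move=> sK [x0 x1 xs]; apply/mem_set; split=> //.
apply: (gface_sub sK); first by apply/fintype.subsetP => v; rewrite inE; exact: xs.
apply/eqP => /setP s0; move: x1; rewrite big1 => [/esym/eqP|v _].
  by rewrite oner_eq0.
by apply/eqP; have := s0 v; rewrite !inE; case: eqP.
Qed.

Lemma convex_hull s : convex (hull s).
Proof.
move=> t t0 th; have szt : (size t)%:R != 0 :> R by rewrite pnatr_eq0 size_eq0.
rewrite /bary; split.
- move=> v; rewrite divr_ge0 // big_seq sumr_ge0 // => x /th[x0 _ _]; exact: x0.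
- rewrite -mulr_suml exchange_big /= big_seq.
  rewrite (eq_bigr (fun=> 1)) => [|x /th[]//].
  by rewrite -big_seq big_const_seq count_predT iter_addr_0 divff.
move=> v; apply: contraNT => vs; rewrite big_seq big1 ?mul0r // => x /th[_ _ xs].
by apply/eqP; apply: contraNT vs; exact: xs.
Qed.

(** The action on all functions, which restricts to [geom_act] on the
    realization; subdivision needs barycenters, which exist in this larger
    space. *)
Definition push (a : gT) x : gvert K -> R := fun v => x (vact a^-1%g v).

Lemma hull_push a s x : hull s x -> hull [set vact a v | v in s]%SET (push a x).
Proof.
move=> [x0 x1 xs]; split=> [v||v].
- exact: x0.
- rewrite -x1 (reindex (@vact _ K a)) /=.
    by apply: eq_bigr => v _; rewrite /push vactK.
  by exists (vact a^-1%g) => v _; [exact: vactK|exact: vactVK].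
by move=> /xs avs; apply/imsetP; exists (vact a^-1%g v); rewrite ?vactVK.
Qed.

Lemma bary_push_act a t : bary (map (push a) t) = push a (bary t).
Proof. exact: bary_push. Qed.

Definition vertex (v : gvert K) : gvert K -> R := fun w => (w == v)%:R.

Lemma push_vertex a v : push a (vertex v) = vertex (vact a v).
Proof.
by apply/funext => w; rewrite /push /vertex (can2_eq (@vactVK _ K a) (vactK a)).
Qed.

Lemma hull_vertex s v : v \in s -> hull s (vertex v).
Proof.
move=> vs; rewrite /vertex; split=> [w||w].
- exact: ler0n.
- by rewrite (bigD1 v) //= eqxx big1 ?addr0 // => w /negPf ->.
by rewrite pnatr_eq0 eqb0 negbK => /eqP ->.
Qed.

Lemma dist_le_vertex v w : dist_le 1 (vertex v) (vertex w).
Proof.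
by move=> u; rewrite /vertex; do 2!case: eqP => _;
  rewrite ?subrr ?subr0 ?sub0r ?normrN ?normr0 ?normr1.
Qed.

End Hull.

End Geometry.

(** * Barycentric coordinates on E_kG *)

Section JoinCoordinates.
Variables (R : realType) (gT : finGroupType).

(** In the join of X with G at parameter t, the last colour k has weight t, and
    the coordinates c of the X-component are scaled by 1 - t. *)
Definition join_coord (X : topologicalType) (c : X -> nat -> gT -> R) (k : nat)
    (p : join_pre R X (discrete_topology gT)) (i : nat) (h : gT) : R :=
  if i == k then set_val p.2 * ((p.1.2 : gT) == h)%:R
  else (1 - set_val p.2) * c p.1.1 i h.

(** The coordinate of a point of E_kG at the element h of the i-th copy of G. *)
Fixpoint ecoord k : EG R gT k -> nat -> gT -> R :=
  match k return EG R gT k -> nat -> gT -> R with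
  | 0 => fun x i h => ((i == 0%N) && ((x : gT) == h))%:R
  | k'.+1 => fun z => join_coord (@ecoord k') k'.+1 (generic_quotient.repr z)
  end.

Lemma ecoordS k p i h :
  ecoord (k := k.+1) (join_pi p) i h = join_coord (@ecoord k) k.+1 p i h.
Proof.
rewrite /= /join_coord.
have : join_rel (generic_quotient.repr (join_pi p)) p.
  by apply/eqmodP; rewrite reprK.
move: (generic_quotient.repr _) => q.
case/or3P => [/eqP -> //|/and3P[/eqP -> /eqP -> /eqP ->]|/and3P[/eqP -> /eqP -> /eqP ->]].
  by rewrite !mul0r.
by rewrite subrr !mul0r.
Qed.

Lemma ecoord_act k (z : EG R gT k) g i h :
  ecoord (gact g z) i (g * h)%g = ecoord z i h.
Proof.
elim: k z => [z|k IH z].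
  by rewrite /= /gdisc_act (inj_eq (mulgI g)).
have [p ->] := join_piP z.
rewrite -[gact g _]/(join_act g _) join_actE !ecoordS /join_coord /join_pre_act /=.
by case: eqP => _; rewrite ?IH // (inj_eq (mulgI g)).
Qed.

Lemma ecoord_inj k (z : EG R gT k) i h h' :
  ecoord z i h != 0 -> ecoord z i h' != 0 -> h = h'.
Proof.
elim: k z => [z|k IH z].
  by rewrite /= !pnatr_eq0 !eqb0 !negbK => /andP[_ /eqP <-] /andP[_ /eqP <-].
have [p ->] := join_piP z.
rewrite !ecoordS /join_coord.
case: (i == k.+1); rewrite !mulf_eq0 !negb_or => /andP[_ h0] /andP[_ h0'].
  by move: h0 h0'; rewrite !pnatr_eq0 !eqb0 !negbK => /eqP <- /eqP <-.
exact: IH h0 h0'.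
Qed.

(** At each join parameter one of the two components has weight at least 1/2. *)
Lemma ecoord_large k (z : EG R gT k) :
  exists i h, (i <= k)%N /\ 2^-1 ^+ k <= ecoord z i h.
Proof.
elim: k z => [z|k IH z]; first by exists 0%N, (z : gT); rewrite /= eqxx.
have [p ->] := join_piP z.
have [t2|t2] := leP 2^-1 (set_val p.2 : R).
  exists k.+1, p.1.2; split=> //; rewrite ecoordS /join_coord !eqxx mulr1.
  by apply: le_trans t2; rewrite exprS ler_piMr ?exprn_ile1 ?invr_ge0 ?invf_le1 ?ler1n.
have [i [h [ik ih]]] := IH p.1.1.
exists i, h; split; first exact: leqW.
rewrite ecoordS /join_coord ltn_eqF ?ltnS // exprS ler_pM ?exprn_ge0 ?invr_ge0 //.
lra.
Qed.

Lemma ecoord_continuous k i h : continuous (fun z : EG R gT k => ecoord z i h).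
Proof.
elim: k => [|k IH].
  by apply/continuousP => A _; exact: discrete_open.
have /quotient_continuous : continuous ((fun z : EG R gT k.+1 => ecoord z i h) \o
   \pi_(quotient_topology {eq_quot join_equiv R (EG R gT k) (gdisc gT)})); last exact.
have -> : (fun z : EG R gT k.+1 => ecoord z i h) \o
   \pi_(quotient_topology {eq_quot join_equiv R (EG R gT k) (gdisc gT)}) =
   fun p : join_pre R (EG R gT k) (gdisc gT) => join_coord (@ecoord k) k.+1 p i h.
  by apply/funext => p; exact: ecoordS.
have ct : continuous (fun p : join_pre R (EG R gT k) (gdisc gT) => set_val p.2 : R).
  move=> p; apply: (@continuous_comp _ _ _ (fun p : join_pre R _ _ => p.2)
    (set_val : @unit_interval R -> R)).
    exact: cvg_snd.
  exact: initial_continuous.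
have cy : continuous (fun p : join_pre R (EG R gT k) (gdisc gT) => ((p.1.2 : gT) == h)%:R : R).
  move=> p; apply: (@continuous_comp _ _ _ (fun p : join_pre R _ (gdisc gT) => p.1.2)
    (fun y : gdisc gT => ((y : gT) == h)%:R : R)).
    by apply: continuous_comp; [exact: cvg_fst|exact: cvg_snd].
  move: {p} p.1.2; apply/continuousP => A _; exact: discrete_open.
have cx : continuous (fun p : join_pre R (EG R gT k) (gdisc gT) => ecoord p.1.1 i h).
  move=> p; apply: (@continuous_comp _ _ _ (fun p : join_pre R (EG R gT k) _ => p.1.1)
    (fun y => ecoord y i h)).
    by apply: continuous_comp; [exact: cvg_fst|exact: cvg_fst].
  exact: IH.
rewrite /join_coord; case: (i == k.+1) => p.
  exact: (continuousM (ct p) (cy p)).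
apply: (@continuousM _ _ (fun p : join_pre R (EG R gT k) (gdisc gT) => 1 - set_val p.2)).
  by apply: cvgB; [exact: cvg_cst|exact: ct].
exact: cx.
Qed.

End JoinCoordinates.

(** * The induced complexes *)

Section CosetComplex.
Variables (gT : finGroupType) (H : {group gT}) (n : nat).
Local Notation V := ('I_n.+1 * gT)%type.

(** A simplex has at most one vertex of each colour i, and its group elements
    lie in one left coset of H. *)
Definition coset_face : {set {set V}} :=
  [set s | (s != finset.set0) && [forall u in s, forall v in s,
    ((u.2^-1 * v.2)%g \in H) && ((u.1 == v.1) ==> (u == v))]]%SET.

Lemma coset_faceP (s : {set V}) : reflect
  (s != finset.set0 /\ forall u v, u \in s -> v \in s ->
     (u.2^-1 * v.2)%g \in H /\ (u.1 = v.1 -> u = v)) (s \in coset_face).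
Proof.
rewrite inE; apply: (iffP andP) => -[s0 sP]; split=> //.
  move=> u v us vs.
  have /andP[-> /implyP uv] := forall_inP (forall_inP sP u us) v vs.
  by split=> // /eqP/uv/eqP.
apply/forall_inP => u us; apply/forall_inP => v vs.
have [-> uv] := sP u v us vs; apply/implyP => /eqP /uv ->; exact: eqxx.
Qed.

Definition coset_act (g : gT) (v : V) : V := (v.1, (g * v.2)%g).

Lemma coset_vertex_inhabited : (0 < #|{: V}|)%N.
Proof. by apply/card_gt0P; exists (ord0, 1%g). Qed.

Lemma coset_face_neq0 : finset.set0 \notin coset_face.
Proof. by rewrite inE eqxx. Qed.

Lemma coset_face_vertex (v : V) : [set v]%SET \in coset_face.
Proof.
apply/coset_faceP; split=> [|u w]; first by apply/set0Pn; exists v; rewrite inE.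
by rewrite !inE => /eqP -> /eqP ->; rewrite mulVg group1.
Qed.

Lemma coset_face_sub (s t : {set V}) :
  s \in coset_face -> t \subset s -> t != finset.set0 -> t \in coset_face.
Proof.
move=> /coset_faceP[_ sP] /fintype.subsetP ts t0; apply/coset_faceP; split=> // u v.
by move=> /ts us /ts vs; exact: sP.
Qed.

Lemma coset_act1 v : coset_act 1%g v = v.
Proof. by case: v => i x; rewrite /coset_act mul1g. Qed.

Lemma coset_actM g h v : coset_act (g * h)%g v = coset_act g (coset_act h v).
Proof. by rewrite /coset_act /= mulgA. Qed.

Lemma coset_act_simplicial g (s : {set V}) :
  s \in coset_face -> [set coset_act g v | v in s]%SET \in coset_face.
Proof.
move=> /coset_faceP[s0 sP]; apply/coset_faceP; split.
  by case/set0Pn: s0 => v vs; apply/set0Pn; exists (coset_act g v); exact: imset_f.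
move=> _ _ /imsetP[u us ->] /imsetP[v vs ->] /=.
have [uv uv1] := sP u v us vs; rewrite invMg mulgA mulgKV; split=> //.
by move=> /uv1 ->.
Qed.

Definition coset_complex : gcomplex gT :=
  GComplex coset_vertex_inhabited coset_face_neq0
    coset_face_vertex coset_face_sub
    coset_act1 coset_actM coset_act_simplicial.

(** An element fixing a point permutes its support, preserves colours, and the
    support has only one vertex of a given colour. *)
Lemma coset_complex_free (R : realType) : gfree (geom R coset_complex).
Proof.
move=> g x gx; have [x0 x1 /coset_faceP[/set0Pn[v vs] sP]] := set_valP x.
have gvs : coset_act g v \in finset (fun v => set_val x v != 0 :> R).
  have e : set_val (gact g x) (coset_act g v) = set_val x v.
    exact: (congr1 (set_val x) (vactK (K := coset_complex) g v)).
  by rewrite inE -[x in set_val x]gx e; rewrite inE in vs.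
have [_ /(_ erefl) e] := sP _ _ vs gvs.
have := congr1 snd e => /= e2.
by apply: (mulIg v.2); rewrite -e2 mul1g.
Qed.

End CosetComplex.

Section CyclicLog.
Variables (gT : finGroupType) (a : gT).

(** Left multiplication by a is free, and its orbits are the right cosets of
    <[a]>; the exponent is counted from a chosen representative. *)
Lemma cyclic_log : exists2 expo : gT -> nat, (forall x, (expo x < #[a]%g)%N) &
  forall x, expo (a * x)%g = ((expo x).+1 %% #[a]%g)%N.
Proof.
pose r x := repr (<[a]> :* x)%g.
pose P x (j : 'I_#[a]%g) := (x == a ^+ j * r x)%g.
have Pex x : exists j, P x j.
  have : (r x * x^-1)%g \in <[a]>%g by rewrite -mem_rcoset; exact: mem_repr_rcoset.
  rewrite -groupV invMg invgK => /cyclePmin[j ja e].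
  by exists (Ordinal ja); rewrite /P /= -e mulgKV.
pose expo x := odflt (Ordinal (order_gt0 a)) [pick j | P x j].
have expoP x : x = (a ^+ expo x * r x)%g.
  by rewrite /expo; case: pickP => [j /eqP //|/= no]; have [j] := Pex x; rewrite no.
exists (fun x => expo x) => [x|x]; first exact: ltn_ord.
have ra : r (a * x)%g = r x.
  by rewrite /r; congr (repr _); apply/rcoset_eqP/rcosetP; exists a; rewrite ?cycle_id.
have : (a ^+ expo (a * x) = a ^+ (expo x).+1)%g.
  apply: (mulIg (r x)); rewrite -{1}ra -expoP expgS -mulgA; congr (_ * _)%g.
  exact: expoP.
by move/eqP; rewrite eq_expg_mod_order => /eqP <-; rewrite modn_small.
Qed.

End CyclicLog.

(** * Non-existence of maps to E_kG with small k *)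

Section Label.
Variables (R : realType) (gT : finGroupType) (k : nat).
Local Notation L := ('I_k.+1 * gT)%type.
Implicit Types (z : EG R gT k) (w : L).

(** The threshold is the one for which [ecoord_large] guarantees a leading
    vertex. *)
Definition leading z w := 2^-1 ^+ k <= ecoord z w.1 w.2 :> R.

(** Taking the least possible colour makes the label unique, hence
    equivariant. *)
Definition EGlabel z : L :=
  odflt (ord0, 1%g) [pick w | leading z w & [forall v, leading z v ==> (w.1 <= v.1)%N]].

Lemma leading_neq0 z w : leading z w -> ecoord z w.1 w.2 != 0.
Proof. by move=> lw; rewrite gt_eqF // (lt_le_trans _ lw) // exprn_gt0 // invr_gt0. Qed.

Lemma EGlabelP z : leading z (EGlabel z) /\
  forall v, leading z v -> ((EGlabel z).1 <= v.1)%N.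
Proof.
rewrite /EGlabel; case: pickP => [w /andP[lw /forallP wP]|no].
  by split=> // v; exact/implyP.
have [i [h [ik ih]]] := ecoord_large z.
have ik' : (i < k.+1)%N by [].
pose w0 : L := (Ordinal ik', h); have lw0 : leading z w0 by [].
case: (@arg_minnP _ w0 (leading z) (fun w => w.1 : nat) lw0) => w lw wmin.
by have := no w; rewrite lw /= => /negP[]; apply/forallP => v; apply/implyP/wmin.
Qed.

Lemma EGlabel_act g z : EGlabel (gact g z) = ((EGlabel z).1, (g * (EGlabel z).2)%g).
Proof.
have lead v : leading (gact g z) v = leading z (v.1, (g^-1 * v.2)%g).
  by rewrite /leading -[in LHS](mulKVg g v.2) ecoord_act.
have [l1 m1] := EGlabelP z; have [l2 m2] := EGlabelP (gact g z).
set w := EGlabel z in l1 m1 *; set w' := EGlabel _ in l2 m2 *.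
have e1 : w'.1 = w.1.
  apply/val_inj/eqP; rewrite eqn_leq.
  have -> : (w.1 <= w'.1)%N by rewrite lead in l2; exact: m1 l2.
  by rewrite (m2 (w.1, (g * w.2)%g)) // lead /= mulKg; case: (w) l1.
case: w' e1 l2 {m2} => i h /= -> l2; congr pair.
apply: (@ecoord_inj R gT k (gact g z) w.1); first exact: (leading_neq0 l2).
by rewrite ecoord_act; exact: leading_neq0.
Qed.

End Label.

Section LowerBound.
Variables (R : realType) (gT : finGroupType) (a : gT) (n k : nat).
Hypothesis a_prime : prime #[a]%g.
Hypothesis kn : (k < n)%N.
Local Notation K := (coset_complex <[a]>%G n).
Local Notation X := (geom R K).
Variable f : X -> EG R gT k.
Hypothesis gf : gmap f.
Local Notation P := (gvert K -> R).
Local Notation p := #[a]%g.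
Local Notation L := ('I_k.+1 * gT)%type.

Local Notation vtx := (@vertex R gT K).

Definition lab_rot (w : L) : L := (w.1, (a * w.2)%g).

(** Total on functions, so that it can be mapped over arbitrary tuples; on the
    realization it is the label of f x ([point_labelE]). *)
Definition point_label (x : P) : L :=
  if insub x : option X is Some y then EGlabel (f y) else (ord0, 1%g).

Lemma point_labelE (y : X) : point_label (set_val y) = EGlabel (f y).
Proof. by rewrite /point_label; have -> := @valK _ _ X y. Qed.

Lemma point_label_push (x : P) : x \in @geom_set R gT K ->
  point_label (push a x) = lab_rot (point_label x).
Proof.
move=> xX; pose y : X := exist _ x xX.
have -> : x = set_val y by [].
rewrite -[push a _]/(set_val (gact a y)) !point_labelE /lab_rot.
by rewrite gf.2 EGlabel_act.
Qed.

(** If the labels of x and y have the same colour but different group elements,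
    then at the label of y the coordinate of f y is at least the threshold,
    while that of f x is zero because its colour is occupied by the label of x.
    Uniform continuity excludes this for close x and y. *)
Lemma labels_compatible : \forall d \near 0^'+, forall x y : X,
  dist_le d (set_val x) (set_val y) ->
  (EGlabel (f x)).1 = (EGlabel (f y)).1 -> EGlabel (f x) = EGlabel (f y).
Proof.
have th0 : 0 < 2^-1 ^+ k :> R by rewrite exprn_gt0 // invr_gt0.
have : \forall d \near 0^'+, forall w : L, forall x y : X,
    dist_le d (set_val x) (set_val y) ->
    `|ecoord (f x) w.1 w.2 - ecoord (f y) w.1 w.2| < 2^-1 ^+ k.
  apply: filter_forall => w.
  apply: (geom_uniform_continuous (u := fun x => ecoord (f x) w.1 w.2)) => // x.
  apply: (@continuous_comp _ _ _ f (fun z => ecoord z w.1 w.2)); first exact: gf.1.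
  exact: ecoord_continuous.
apply: filterS => d dP x y /dP xy e.
have [lx _] := EGlabelP (f x); have [ly _] := EGlabelP (f y).
case: (EGlabel (f x)) e lx => i h /= -> lx.
case: (EGlabel (f y)) lx ly => j h' /= lx ly; congr pair.
apply: (@ecoord_inj R gT k (f x) j); first exact: (leading_neq0 lx).
have := xy (j, h'); rewrite /=; apply: contraTneq => ->.
by rewrite sub0r normrN -leNgt (le_trans ly) // ler_norm.
Qed.

Definition chain_vertex (i : nat) : gvert K := (inord i, 1%g).

(** The tuples in the chain z_i, whose cone points are [chain_vertex]: vertices
    with distinct colours below i and group elements in <[a]>. *)
Definition chain_simplex (i : nat) (s : seq P) : Prop :=
  (i <= n.+1)%N -> exists vs : seq (gvert K),
    [/\ s = map (vtx) vs, size vs = i, {in vs &, injective fst} &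
     forall v, v \in vs -> (v.1 < i)%N /\ v.2 \in <[a]>%g].

Lemma iter_push j (x : P) : iter j (push a) x = push (a ^+ j)%g x.
Proof.
elim: j => [|j IH]; apply/funext => v; first by rewrite /push invg1 vact1.
by rewrite iterS IH expgS /push invMg vactM.
Qed.

Lemma iter_push_vertex j (v : gvert K) :
  iter j (push a) (vtx v) = vtx (vact (a ^+ j)%g v).
Proof. by rewrite iter_push push_vertex. Qed.

Lemma chain_simplexS i s j : chain_simplex i s ->
  chain_simplex i.+1 (vtx (chain_vertex i) :: map (iter j (push a)) s).
Proof.
move=> Wi ilt; have [|vs [-> szv uv vP]] := Wi; first exact: ltnW.
have ii : (@inord n i : nat) = i by rewrite inordK.
exists (chain_vertex i :: map (vact (a ^+ j)%g) vs); split.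
- rewrite /= -!map_comp; congr cons; apply: eq_map => v /=.
  exact: iter_push_vertex.
- by rewrite /= size_map szv.
- have new w : w \in vs -> (vact (a ^+ j)%g w).1 <> (chain_vertex i).1.
    by move=> /vP[+ _] /= e; rewrite e ii ltnn.
  move=> _ _ /predU1P[->|/mapP[u us ->]] /predU1P[->|/mapP[w ws ->]] // e.
  - by case: (new w ws).
  - by case: (new u us).
  by rewrite (uv u w us ws e).
move=> v; rewrite inE => /orP[/eqP ->|/mapP[w /vP[wi wa] ->]] /=.
  by rewrite ii group1.
by rewrite ltnS ltnW // groupM // groupX // cycle_id.
Qed.

Lemma chain_simplex_face i s : chain_simplex i s -> (i <= n.+1)%N -> 
  size s = i /\ exists2 t, t \in gface K & forall x, x \in s ->
    exists2 v, v \in t & x = vtx v.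
Proof.
move=> Wi /Wi [vs [-> szv uv vP]]; split; first by rewrite size_map.
have [vs0|/negP vs0] := eqVneq vs [::].
  exists [set chain_vertex 0%N]%SET; first exact: gface_vertex.
  by rewrite vs0.
exists [set v in vs]%SET.
  apply/coset_faceP; split.
    case: vs vs0 {szv uv vP} => // v vs _; apply/set0Pn; exists v.
    by rewrite inE mem_head.
  move=> u v; rewrite !inE => us ws; have [_ ua] := vP u us; have [_ va] := vP v ws.
  split; first by rewrite groupM // groupV.
  exact: uv.
by move=> _ /mapP[v vv ->]; exists v; rewrite ?inE.
Qed.

(** Small tuples are those of diameter at most d within one closed simplex; m
    subdivisions reach this size.  There are k + 1 colours, so the chains up to
    z_(k+2) are needed, and these exist in dimension k + 1 <= n. *)
Lemma no_map_to_small_EG : False.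
Proof.
have [expo expo_lt expo_a] := cyclic_log a.
have [d [d0 labd]] := filter_ex (filterI (nbhs_right_gt (0 : R)) labels_compatible).
have [m md] := exp_ratio_small n d0.
pose good (s : seq P) := exists2 t, t \in gface K &
  (forall x, x \in s -> hull t x) /\
  (forall x y, x \in s -> y \in s -> dist_le d x y).
apply: (@no_good_labelling 'F_p p k.+1 _ _ P (push a) (@bary R (gvert K))
  (fun i => vtx (chain_vertex i)) _ _ L lab_rot (fun w => w.1 : nat)
  (fun w => expo w.2) _ _ _ _ _ point_label good m).
- exact: order_gt0.
- exact/pcharf0/pchar_Fp.
- move=> x; rewrite iter_push expg_order.
  by apply/funext => v; rewrite /push invg1 vact1.
- exact: bary_push_act.
- have rotE j w : iter j lab_rot w = (w.1, (a ^+ j * w.2)%g).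
    elim: j => [|j IH]; first by rewrite mul1g; case: w.
    by rewrite iterS IH /lab_rot /= expgS mulgA.
  by case=> i x; rewrite rotE expg_order mul1g.
- by move=> w; exact: ltn_ord.
- by [].
- by move=> w; exact: expo_lt.
- by move=> w; exact: expo_a.
- move=> s x [t tK [st _]] /st xt; apply: point_label_push; exact: hull_geom xt.
- move=> s [t tK [st sd]]; exists [set vact a v | v in t]%SET.
    exact: vact_simplicial.
  split=> [_ /mapP[x /st xt ->]|_ _ /mapP[x xs ->] /mapP[y ys ->] v].
    exact: hull_push.
  exact: (sd x y xs ys (vact a^-1%g v)).
- move=> s [t tK [st sd]] _ _ /mapP[x xs ->] /mapP[y ys ->].
  have xX := hull_geom tK (st x xs); have yX := hull_geom tK (st y ys).
  have := sd x y xs ys.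
  rewrite -[x]/(set_val (exist _ x xX : X)) -[y]/(set_val (exist _ y yX : X)).
  by rewrite !point_labelE => /labd xy e; apply/xy/val_inj.
move=> i phi psi ik eq_ff; have in1 : (i <= n.+1)%N by rewrite (leq_trans ik).
apply: (@chain_eval_support _ _ _ _ _ chain_simplex).
- by exists [::].
- by move=> j s l; exact: chain_simplexS.
move=> s /chain_simplex_face /(_ in1)[szs [t tK st]].
apply: (@iter_subdiv_support _ _ _ n m i phi psi s 1 (hull t)) => //.
- exact: convex_hull.
- by move=> x /st[v vt ->]; exact: hull_vertex.
- by move=> x y /st[v _ ->] /st[w _ ->]; exact: dist_le_vertex.
move=> u szu ut ud; apply: eq_ff => //; exists t => //; split=> // x y xu yu v.
by apply: le_trans (ud x y xu yu v) _; rewrite mulr1 ltW.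
Qed.

End LowerBound.

(** * Maps into joins *)

Section JoinMaps.
Variable R : realType.

Lemma clamp_subproof (t : R) : Num.min 1 (Num.max 0 t) \in @unit_interval R.
Proof.
apply/mem_set; rewrite /unit_interval /= in_itv /=.
by rewrite le_min ler01 le_max lexx ge_min lexx.
Qed.

(** Retraction of the line onto the interval.  Join parameters below are clamped
    affine functions that are constant near the ends of the interval; there one
    of the two components no longer matters, and near such a point a map into a
    join is locally given by a formula in which that component is replaced by a
    constant.  This avoids any discussion of neighbourhoods in the quotient
    topology. *)
Definition clamp (t : R) : @unit_interval R :=
  exist _ (Num.min 1 (Num.max 0 t)) (clamp_subproof t).

Lemma clampE t : set_val (clamp t) = Num.min 1 (Num.max 0 t) :> R. Proof. by []. Qed.

Lemma clamp0 t : t <= 0 -> set_val (clamp t) = 0 :> R.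
Proof. by move=> t0; rewrite clampE max_l // min_r. Qed.

Lemma clamp1 t : 1 <= t -> set_val (clamp t) = 1 :> R.
Proof. by move=> t1; rewrite clampE max_r ?(le_trans _ t1) // min_l. Qed.

Lemma clamp_continuous : continuous clamp.
Proof.
apply: continuous_comp_initial => t.
apply: (@continuous_min R R (cst 1) (fun t => Num.max 0 t)); first exact: cst_continuous.
by apply: (@continuous_max R R (cst 0) id); [exact: cst_continuous|move=> ?; exact: cvg_id].
Qed.

Lemma near_eq_continuous (T U : topologicalType) (f g : T -> U) (x : T) :
  (\forall y \near x, f y = g y) -> {for x, continuous g} -> {for x, continuous f}.
Proof.
move=> fg cg; rewrite /prop_for /continuous_at (nbhs_singleton fg).
by apply: cvg_trans cg; apply: near_eq_cvg; apply: filterS fg => y ->.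
Qed.

Section JoinPi.
Variables X Y : topologicalType.

Lemma join_pi0 x (y y' : Y) (s t : @unit_interval R) :
  set_val s = 0 :> R -> set_val t = 0 :> R -> join_pi (x, y, s) = join_pi (x : X, y', t).
Proof. by move=> s0 t0; apply/eqmodP; rewrite /= /join_rel /= s0 t0 !eqxx orbT. Qed.

Lemma join_pi1 (x x' : X) y (s t : @unit_interval R) :
  set_val s = 1 :> R -> set_val t = 1 :> R -> join_pi (x, y, s) = join_pi (x', y : Y, t).
Proof. by move=> s0 t0; apply/eqmodP; rewrite /= /join_rel /= s0 t0 !eqxx !orbT. Qed.

Lemma join_pi_continuous_at (T : topologicalType) (f : T -> X) (g : T -> Y)
    (t : T -> R) (x : T) :
  {for x, continuous f} -> {for x, continuous g} -> {for x, continuous t} ->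
  {for x, continuous (fun z => join_pi (f z, g z, clamp (t z)))}.
Proof.
move=> cf cg ct.
apply: (@continuous_comp _ _ _ (fun z => (f z, g z, clamp (t z)) : join_pre R X Y)
  (@join_pi R X Y)); last first.
  exact: pi_continuous.
apply: (@cvg_pair _ _ _ (nbhs x) (nbhs (f x, g x)) (nbhs (clamp (t x)))).
  exact: (@cvg_pair _ _ _ (nbhs x) (nbhs (f x)) (nbhs (g x))).
by apply: continuous_comp => //; exact: clamp_continuous.
Qed.

End JoinPi.
End JoinMaps.

Section MapToEG.
Variables (R : realType) (gT : finGroupType) (T : gspace gT).
Variables (w : nat -> T -> R) (kappa : nat -> T -> gT).
Hypothesis w_ge0 : forall i x, 0 <= w i x.
Hypothesis w_cont : forall i, continuous (w i).
Hypothesis w_act : forall i g x, w i (gact g x) = w i x.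
Hypothesis kappa_loc : forall i x, 0 < w i x -> \forall y \near x, kappa i y = kappa i x.
Hypothesis kappa_act : forall i g x, 0 < w i x -> kappa i (gact g x) = (g * kappa i x)%g.

Lemma kappa_continuous i x : 0 < w i x ->
  {for x, continuous (kappa i : T -> gdisc gT)}.
Proof.
move=> /kappa_loc kx.
apply: (@near_eq_continuous T (gdisc gT) (kappa i) (fun=> kappa i x) x kx).
exact: cst_continuous.
Qed.

(** Weights w_i with w_i > 0 somewhere at each point, together with locally
    constant equivariant maps kappa_i to G on the sets where w_i > 0, define a
    map to a join of copies of G.  For the induction f is a total function, but
    it is only required to be good at the points where the weights used so far
    do not all vanish. *)
Lemma map_to_EG k : exists f : T -> EG R gT k,
  forall x, 0 < \sum_(i < k.+1) w i x ->
    {for x, continuous f} /\ forall g, f (gact g x) = gact g (f x).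
Proof.
elim: k => [|k [f fP]].
  exists (kappa 0%N) => x; rewrite big_ord1 => wx.
  by split=> [|g]; [exact: kappa_continuous|exact: kappa_act].
pose S x := \sum_(i < k.+1) w i x.
pose t x := w k.+1 x / (S x + w k.+1 x).
have S0 x : 0 <= S x by apply: sumr_ge0.
have cS : continuous S by apply: continuous_sum.
(* The last copy of G has relative weight t; the clamped parameter is 0 for
   t <= 1/3 and 1 for t >= 2/3, and strictly between these values both parts
   have positive weight. *)
exists (fun x => join_pi (f x, kappa k.+1 x : gdisc gT, clamp (3 * t x - 1))) => x.
rewrite big_ord_recr /= -/(S x) => Sw.
have ct : {for x, continuous t}.
  apply: (@continuousM R _ (w k.+1)); first exact: w_cont.
  apply: continuousV; first by rewrite gt_eqF.
  by apply: (@continuousD _ _ _ S); [exact: cS|exact: w_cont].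
have cu : {for x, continuous (fun x => 3 * t x - 1)}.
  apply: (@continuousB _ _ _ (fun x => 3 * t x)); last exact: cst_continuous.
  by apply: (@continuousM R _ (cst 3)); [exact: cst_continuous|].
have t_act g : t (gact g x) = t x.
  rewrite /t w_act; congr (_ / (_ + _)).
  by apply: eq_bigr => i _; rewrite w_act.
have txE : t x * (S x + w k.+1 x) = w k.+1 x by rewrite /t divfK // gt_eqF.
have [t_lt|t_ge] := ltP (t x) (1 / 3).
  have Sx : 0 < S x by have := w_ge0 k.+1 x; nra.
  have [cf fg] := fP x Sx; split=> [|g].
    apply: (@near_eq_continuous _ _ _
      (fun y => join_pi (f y, 1%g : gdisc gT, clamp 0))); last first.
      by apply: join_pi_continuous_at => //; exact: cst_continuous.
    have near_t : \forall y \near x, t y < 1 / 3.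
      exact: (cvgr_lt _ ct).
    apply: filterS near_t => y ty; apply: join_pi0; rewrite clamp0 //; lra.
  rewrite t_act -[RHS]/(join_act g _) join_actE /join_pre_act /= fg.
  by apply: join_pi0; rewrite clamp0 //; lra.
have wx : 0 < w k.+1 x by have := S0 x; nra.
have [t_gt|t_le] := ltP (2 / 3) (t x).
  split=> [|g].
    apply: (@near_eq_continuous _ _ _
      (fun y => join_pi (f x, kappa k.+1 y : gdisc gT, clamp 1))); last first.
      by apply: join_pi_continuous_at; try exact: cst_continuous; exact: kappa_continuous.
    have near_t : \forall y \near x, 2 / 3 < t y.
      exact: (cvgr_gt _ ct).
    apply: filterS near_t => y ty; apply: join_pi1; rewrite clamp1 //; lra.
  rewrite t_act -[RHS]/(join_act g _) join_actE /join_pre_act /= kappa_act //.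
  by apply: join_pi1; rewrite clamp1 //; lra.
have Sx : 0 < S x by nra.
have [cf fg] := fP x Sx; split=> [|g].
  by apply: join_pi_continuous_at => //; exact: kappa_continuous.
by rewrite t_act -[RHS]/(join_act g _) join_actE /join_pre_act /= fg kappa_act.
Qed.

End MapToEG.

(** * Maps out of induced complexes and of their joins *)

Section CosetComplexMaps.
Variables (R : realType) (gT : finGroupType) (H : {group gT}) (n : nat).
Local Notation K := (coset_complex H n).
Local Notation X := (geom R K).
Local Open Scope group_scope.

(** Positivity, rather than being nonzero, is an open condition. *)
Definition support_vertex (x : X) (v : gvert K) := (0 < set_val x v :> R)%R.

Lemma support_vertexP (x : X) u v : support_vertex x u -> support_vertex x v ->
  (u.2^-1 * v.2)%g \in H /\ (u.1 = v.1 -> u = v).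
Proof.
have [_ _ /coset_faceP[_ xP]] := set_valP x => xu xv.
by apply: xP; rewrite inE gt_eqF.
Qed.

Lemma support_vertex_exists (x : X) : exists v, support_vertex x v.
Proof.
have [x0 _ /coset_faceP[/set0Pn[v]]] := set_valP x; rewrite inE => xv _.
by exists v; rewrite /support_vertex lt_def xv x0.
Qed.

Lemma support_vertex_near (x : X) v : support_vertex x v ->
  \forall y \near x, support_vertex y v.
Proof. by move=> xv; exact: (cvgr_gt _ (@geom_coord_continuous R gT K v x) 0%R xv). Qed.

Lemma support_vertex_act (x : X) g v :
  support_vertex x v -> support_vertex (gact g x) (coset_act g v).
Proof.
move=> xv; have e : set_val (gact g x) (coset_act g v) = set_val x v :> R.
  exact: (congr1 (set_val x) (vactK (K := K) g v)).
by rewrite /support_vertex e.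
Qed.

(** The left coset of H over which x lies, see [support_cosetE]. *)
Definition support_coset (x : X) : {set gT} :=
  [set h | [exists v : gvert K, support_vertex x v && (v.2^-1 * h \in H)]]%SET.

Lemma support_cosetE (x : X) v : support_vertex x v -> support_coset x = (v.2 *: H)%g.
Proof.
move=> xv; apply/setP => h; rewrite inE mem_lcoset; apply/existsP/idP.
  move=> [u /andP[xu uh]]; have [vu _] := support_vertexP xv xu.
  by rewrite -[h](mulKVg u.2) mulgA groupM.
by move=> vh; exists v; rewrite xv.
Qed.

Lemma support_coset_act g (x : X) : support_coset (gact g x) = (g *: support_coset x)%g.
Proof.
have [v xv] := support_vertex_exists x.
rewrite (support_cosetE xv) (support_cosetE (support_vertex_act g xv)) /=.
by rewrite lcosetM.
Qed.

Lemma support_coset_near (x : X) : \forall y \near x, support_coset y = support_coset x.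
Proof.
have [v xv] := support_vertex_exists x.
apply: filterS (support_vertex_near xv) => y yv.
by rewrite (support_cosetE xv) (support_cosetE yv).
Qed.

Lemma coset_complex_map : exists f : X -> EG R gT n, gmap f.
Proof.
pose w i (x : X) : R := (\sum_h set_val x (inord i, h))%R.
pose kappa i (x : X) : gT := odflt 1 [pick h | support_vertex x (inord i, h)].
have kappaE i x h : support_vertex x (inord i, h) -> kappa i x = h.
  rewrite /kappa => xh; case: pickP => [h' xh'|/(_ h)]; last by rewrite xh.
  by have [_ /(_ erefl)[]] := support_vertexP xh' xh.
have x_ge0 (x : X) v : (0 <= set_val x v :> R)%R.
  by have [x0 _ _] := set_valP x; exact: x0.
have wP i x : (0 < w i x)%R -> support_vertex x (inord i, kappa i x).
  move=> wx; have [h xh] : exists h, support_vertex x (inord i, h).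
    apply: contrapT => /forallNP no; move: wx; rewrite /w big1 ?ltxx // => h _.
    by apply/eqP; rewrite eq_le x_ge0 andbT leNgt; apply/negP/no.
  by rewrite (kappaE i x h).
have w_act i g (x : X) : w i (gact g x) = w i x.
  rewrite /w (reindex_inj (mulgI g)); apply: eq_bigr => h _.
  exact: (congr1 (set_val x) (vactK (K := K) g (inord i, h))).
have w_ge0 i x : (0 <= w i x)%R by apply: sumr_ge0.
have w_cont i : continuous (w i).
  by apply: continuous_sum => h; exact: geom_coord_continuous.
have kappa_loc i x : (0 < w i x)%R -> \forall y \near x, kappa i y = kappa i x.
  by move=> /wP /support_vertex_near; apply: filterS => y; exact: kappaE.
have kappa_act i g x : (0 < w i x)%R -> kappa i (gact g x) = (g * kappa i x)%g.
  by move=> /wP /(support_vertex_act g); exact: kappaE.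
have [f fP] := map_to_EG w_ge0 w_cont w_act kappa_loc kappa_act n.
have w1 x : (0 < \sum_(i < n.+1) w i x)%R.
  have [_ x1 _] := set_valP x.
  rewrite (_ : (\sum_(i < n.+1) _)%R = 1%R) // -x1 pair_big /=.
  by apply: eq_bigr => -[i h] _ /=; rewrite inord_val.
by exists f; split=> [x|g x]; have [fx fg] := fP x (w1 x).
Qed.

End CosetComplexMaps.

Section FreeOrbits.
Variables (gT : finGroupType) (S : finType) (act : gT -> S -> S).
Hypothesis act1 : forall s, act 1%g s = s.
Hypothesis actM : forall g h s, act (g * h)%g s = act g (act h s).

(** The choice of a representative depends only on the orbit, because [pick]
    depends only on the extension of a predicate.  Freeness is required pointwise
    since the action on pairs of sets is only free on pairs of cosets. *)
Lemma free_orbit_map : exists theta : S -> gT,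
  forall s, (forall g, act g s = s -> g = 1%g) ->
    forall g, theta (act g s) = (g * theta s)%g.
Proof.
pose r s := odflt s [pick t | [exists g, t == act g s]].
pose theta s := odflt 1%g [pick g | s == act g (r s)].
have rP s : exists g, s = act g (r s).
  rewrite /r; case: pickP => [t /existsP[g /eqP ->]|/(_ s)/existsP[]].
    by exists g^-1%g; rewrite -actM mulVg act1.
  by exists 1%g; rewrite act1.
have thetaP s : s = act (theta s) (r s).
  rewrite /theta; case: pickP => [g /eqP //|no]; have [g] := rP s.
  by move/eqP; rewrite no.
have ract g s : r (act g s) = r s.
  rewrite /r (@eq_pick _ _ (fun t => [exists g, t == act g s])); last first.
    move=> t; apply/existsP/existsP => -[h /eqP ->].
      by exists (h * g)%g; rewrite actM.
    by exists (h * g^-1)%g; rewrite -actM mulgKV.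
  by case: pickP => // /(_ s)/existsP[]; exists 1%g; rewrite act1.
exists theta => s free g.
set u := theta (act g s); set v := (g * theta s)%g.
have uv : act u (r s) = act v (r s).
  by rewrite /u /v -{1}(ract g s) -thetaP actM -thetaP.
have /free /(canRL (mulgK _)) : act (theta s * (v^-1 * u) * (theta s)^-1)%g s = s.
  rewrite {3}(thetaP s) -actM mulgKV !actM uv -(actM v^-1%g) mulVg act1.
  by rewrite -thetaP.
rewrite invgK mul1g -[RHS]mulg1 => /mulgI e.
by rewrite -[u]mul1g -(mulgV v) -mulgA e mulg1.
Qed.

End FreeOrbits.

Section JoinUpperBound.
Variables (R : realType) (gT : finGroupType) (X Y Z : gspace gT).
Variables (fX : X -> Z) (fY : Y -> Z) (c : X -> Y -> gT).
Hypotheses (gfX : gmap fX) (gfY : gmap fY).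
Hypothesis c_act : forall g x y, c (gact g x) (gact g y) = (g * c x y)%g.
Hypothesis c_loc : forall x y,
  \forall q \near (x, y), c q.1 q.2 = c x y.

(** At the parameter 1/2 the formulas agree, as both parameters are clamped to 1,
    where the join only sees c x y; both formulas are in fact valid on the
    middle third of the interval, which gives continuity. *)
Definition join_via (p : join_pre R X Y) : gjoin R Z (gdisc gT) :=
  let: (x, y, t) := p in
  if set_val t <= 2^-1 :> R then join_pi (fX x, c x y : gdisc gT, clamp (3 * set_val t))
  else join_pi (fY y, c x y : gdisc gT, clamp (3 - 3 * set_val t)).

Lemma join_via_lt p : set_val p.2 < 2 / 3 :> R ->
  join_via p = join_pi (fX p.1.1, c p.1.1 p.1.2 : gdisc gT, clamp (3 * set_val p.2)).
Proof.
case: p => -[x y] t /= t3; case: ifPn => //; rewrite -ltNge => t2.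
by apply: join_pi1; rewrite clamp1 //; lra.
Qed.

Lemma join_via_gt p : 1 / 3 < set_val p.2 :> R ->
  join_via p = join_pi (fY p.1.2, c p.1.1 p.1.2 : gdisc gT, clamp (3 - 3 * set_val p.2)).
Proof.
case: p => -[x y] t /= t3; case: ifPn => // t2.
by apply: join_pi1; rewrite clamp1 //; lra.
Qed.

Lemma join_via_continuous : continuous join_via.
Proof.
move=> p.
have ct : continuous (fun p : join_pre R X Y => set_val p.2 : R).
  move=> q; apply: (@continuous_comp _ _ _ (fun p : join_pre R X Y => p.2)
    (set_val : @unit_interval R -> R)).
    exact: cvg_snd.
  exact: initial_continuous.
have c3 : continuous (fun p : join_pre R X Y => 3 * set_val p.2 : R).
  move=> q; apply: (@continuousM R (join_pre R X Y) (cst 3) (fun p => set_val p.2)).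
    exact: cst_continuous.
  exact: ct.
have cfst : continuous (fun p : join_pre R X Y => p.1) by move=> q; exact: cvg_fst.
have cc : {for p, continuous (fun p : join_pre R X Y => c p.1.1 p.1.2 : gdisc gT)}.
  have : \forall q \near p, c q.1.1 q.1.2 = c p.1.1 p.1.2.
    have c_near : \forall q \near p.1, c q.1 q.2 = c p.1.1 p.1.2.
      by case: p => -[x y] t; exact: c_loc.
    exact: (cfst p _ c_near).
  move=> cn; apply: (@near_eq_continuous _ (gdisc gT) _
    (fun=> c p.1.1 p.1.2 : gdisc gT) p cn).
  exact: cst_continuous.
have [t3|t3] := ltP (set_val p.2 : R) (2 / 3).
  have near_t : \forall q \near p, set_val q.2 < 2 / 3 :> R.
    exact: (cvgr_lt _ (ct p) _ t3).
  apply: (near_eq_continuous (filterS (@join_via_lt) near_t)).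
  apply: join_pi_continuous_at => //.
    apply: (@continuous_comp _ _ _ (fun p : join_pre R X Y => p.1.1) fX); last exact: gfX.1.
    by apply: continuous_comp; [exact: cfst|exact: cvg_fst].
  exact: c3.
have t3' : 1 / 3 < set_val p.2 :> R by lra.
have near_t : \forall q \near p, 1 / 3 < set_val q.2 :> R.
  exact: (cvgr_gt _ (ct p) _ t3').
apply: (near_eq_continuous (filterS (@join_via_gt) near_t)).
apply: join_pi_continuous_at => //.
  apply: (@continuous_comp _ _ _ (fun p : join_pre R X Y => p.1.2) fY); last exact: gfY.1.
  by apply: continuous_comp; [exact: cfst|exact: cvg_snd].
apply: (@continuousB _ _ _ (cst 3 : join_pre R X Y -> R) (fun p => 3 * set_val p.2)).
  exact: cst_continuous.
exact: c3.
Qed.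

Lemma join_via_rel p q : join_rel p q -> join_via p = join_via q.
Proof.
case/or3P => [/eqP -> //|/and3P[/eqP p0 /eqP q0 /eqP e]|/and3P[/eqP p1 /eqP q1 /eqP e]].
  have lt23 : (0 < 2 / 3 :> R)%R by lra.
  rewrite !join_via_lt ?p0 ?q0 //.
  by rewrite e; apply: join_pi0; rewrite clamp0 ?p0 ?q0 ?mulr0.
have gt13 : (1 / 3 < 1 :> R)%R by lra.
rewrite !join_via_gt ?p1 ?q1 //.
by rewrite e; apply: join_pi0; rewrite clamp0 ?p1 ?q1 ?mulr1 ?subrr.
Qed.

Lemma join_map : exists f : gjoin R X Y -> gjoin R Z (gdisc gT), gmap f.
Proof.
pose f (z : gjoin R X Y) :=
  join_via (generic_quotient.repr (z : {eq_quot join_equiv R X Y})).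
have fE p : f (join_pi p) = join_via p.
  by apply/join_via_rel/eqmodP; rewrite reprK.
exists f; split.
  have /quotient_continuous : continuous
    (f \o \pi_(quotient_topology {eq_quot join_equiv R X Y})); last exact.
  rewrite (_ : f \o _ = join_via); first exact: join_via_continuous.
  by apply/funext => p; exact: fE.
move=> g z; have [[[x y] t] ->] := join_piP z.
rewrite -[gact g _ in LHS]/(join_act g _) join_actE !fE /join_pre_act /=.
by case: ifP => _; rewrite -[RHS]/(join_act g _) join_actE /join_pre_act /=
  c_act ?gfX.2 ?gfY.2.
Qed.

End JoinUpperBound.

Section CosetJoin.
Variables (R : realType) (gT : finGroupType) (H H' : {group gT}) (n : nat).
Hypothesis conj_disjoint : forall x, (H :^ x :&: H' = 1)%g.

(** The stabilizer of the pair (x H, y H') is the intersection of conjugates of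
    H and H', which is trivial by hypothesis. *)
Lemma coset_pair_map : exists theta : {set gT} -> {set gT} -> gT,
  forall x y g, theta (g *: (x *: H))%g (g *: (y *: H'))%g =
    (g * theta (x *: H) (y *: H'))%g.
Proof.
pose act g (s : {set gT} * {set gT}) := (g *: s.1, g *: s.2)%g.
have act1 s : act 1%g s = s by case: s => A B; rewrite /act !lcoset1.
have actM g h s : act (g * h)%g s = act g (act h s) by rewrite /act !lcosetM.
have [theta thetaP] := free_orbit_map act1 actM.
exists (fun A B => theta (A, B)) => x y g.
apply: (thetaP (x *: H, y *: H')%g) => {}g [gx gy].
have xg : (x^-1 * g * x)%g \in H.
  have : (g * x)%g \in (x *: H)%g.
    by rewrite -gx mem_lcoset mulKg mem_lcoset mulVg group1.
  by rewrite mem_lcoset mulgA.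
have yg : (y^-1 * g * y)%g \in H'.
  have : (g * y)%g \in (y *: H')%g.
    by rewrite -gy mem_lcoset mulKg mem_lcoset mulVg group1.
  by rewrite mem_lcoset mulgA.
have : (y^-1 * g * y)%g \in (H :^ (x^-1 * y) :&: H')%g.
  rewrite inE yg andbT.
  have -> : (y^-1 * g * y = (x^-1 * g * x) ^ (x^-1 * y))%g.
    by rewrite conjgE invMg invgK !mulgA !mulgK.
  by rewrite memJ_conjg.
rewrite conj_disjoint inE -mulgA -conjgE conjg_eq1; exact/eqP.
Qed.

Lemma coset_join_map : exists f : gjoin R (geom R (coset_complex H n))
  (geom R (coset_complex H' n)) -> EG R gT n.+1, gmap f.
Proof.
have [fX gfX] := coset_complex_map R H n.
have [fY gfY] := coset_complex_map R H' n.
have [theta thetaP] := coset_pair_map.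
pose c (x : geom R (coset_complex H n)) (y : geom R (coset_complex H' n)) :=
  theta (support_coset x) (support_coset y).
have c_act g x y : c (gact g x) (gact g y) = (g * c x y)%g.
  have [u xu] := support_vertex_exists x; have [v yv] := support_vertex_exists y.
  by rewrite /c !support_coset_act (support_cosetE xu) (support_cosetE yv) thetaP.
have c_loc x y : \forall q \near (x, y), c q.1 q.2 = c x y.
  exists ([set x' | support_coset x' = support_coset x],
    [set y' | support_coset y' = support_coset y]).
    by split; exact: support_coset_near.
  by case=> x' y' [/= x'x y'y]; rewrite /c x'x y'y.
exact: (join_map R gfX gfY c_act c_loc).
Qed.

End CosetJoin.

(** * Subgroups of prime order and the join defect *)

Section Groups.
Variable gT : finGroupType.
Local Notation G := [set: gT]%G.
Local Open Scope group_scope.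

(** In the p-group case, a subgroup of order p that meets a central subgroup
    <[z]> of order p after conjugation is conjugate to it, hence equal to it. *)
Lemma disjoint_prime_cycles :
  G != 1%G ->
  ~ (cyclic G /\ exists p m : nat, prime p /\ #|gT| = (p ^ m)%N) ->
  ~ (exists k : nat, (3 <= k)%N /\ G \isog 'Q_((2 ^ k)%N)) ->
  exists a b : gT, [/\ prime #[a]%g, prime #[b]%g &
    forall x, (<[a]> :^ x :&: <[b]> = 1)%g].
Proof.
move=> ntG not_cyclic not_quaternion.
have G1 : (1 < #|G|)%N by rewrite cardG_gt1.
pose p := pdiv #|G|; have p_pr : prime p by exact: pdiv_prime.
have [pG|] := boolP (p.-group G); last first.
  rewrite /pgroup => /pnatP-/(_ (cardG_gt0 G))/existsNP[q].
  move=> /not_implyP[q_pr /not_implyP[qG /negP qp]].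
  have [a _ oa] := Cauchy q_pr qG; have [b _ ob] := Cauchy p_pr (pdiv_dvd _).
  exists a, b; rewrite oa ob; split=> // x; apply: coprime_TIg.
  by rewrite cardJg -!orderE oa ob prime_coprime // dvdn_prime2.
have Ohm1_card : #|'Ohm_1(G)%g| <> p.
  move=> /(prime_Ohm1P pG ntG)/orP[cycG|/andP[_ /eqP/quaternion_classP[k k2 isoG]]].
    apply: not_cyclic; split=> //; have [m oG] := p_natP pG.
    by exists p, m; rewrite -oG cardsT.
  by apply: not_quaternion; exists k.
have ntZ : 'Z(G)%g != 1%g.
  by apply: contra_neq ntG => /(trivg_center_pgroup pG) G1'; apply/val_inj.
have [_ pZ _] := pgroup_pdiv (pgroupS (center_sub G) pG) ntZ.
have [z zZ oz] := Cauchy p_pr pZ.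
have [a ap az] : exists2 a : gT, (a ^+ p = 1)%g & a \notin <[z]>%g.
  apply: contrapT => no; apply: Ohm1_card.
  have -> : ('Ohm_1(G) = <[z]>)%g.
    apply/eqP; rewrite finset.eqEsubset (OhmE 1 pG) expn1 gen_subG gen_subG.
    apply/andP; split; apply/fintype.subsetP => x.
      rewrite !inE => /andP[_ /eqP xp]; apply: contrapT => /negP xz.
      by apply: no; exists x.
    by rewrite inE => /eqP ->; rewrite mem_gen // !inE -oz expg_order eqxx.
  by rewrite -orderE.
have oa : #[a]%g = p.
  have : (#[a]%g %| p)%N by rewrite order_dvdn ap.
  case/primeP: p_pr => _ H /H /orP[|/eqP //]; rewrite order_eq1 => /eqP a1.
  by rewrite a1 group1 in az.
exists a, z; rewrite oa oz; split=> // x; rewrite finset.setIC.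
apply: prime_TIg; first by rewrite -orderE oz.
apply: contra az => zax.
have /eqP za : (<[z]> == <[a]> :^ x)%g.
  by rewrite eqEcard zax cardJg -!orderE oa oz leqnn.
have zx : (<[z]> :^ x = <[z]>)%g.
  by rewrite -cycleJ conjgE -(centerC (finset.in_setT x) zZ) mulKg.
have : (<[a]> :^ x = <[z]> :^ x)%g by rewrite zx za.
by move/conjsg_inj => <-; exact: cycle_id.
Qed.

End Groups.

Section Index.
Variables (R : realType) (gT : finGroupType).

Lemma ind_le (X : gspace gT) k : (exists f : X -> EG R gT k, gmap f) ->
  (ind R X <= (k%:Z)%:E)%E.
Proof.
move=> fX; rewrite /ind; case: pselect => [h|[]]; last by exists k; exact/asboolP.
by case: ex_minnP => m _ /(_ k (asboolT fX)) mk; rewrite lee_fin.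
Qed.

Lemma ind_coset_complex (a : gT) n : prime #[a]%g ->
  ind R (geom R (coset_complex <[a]>%G n)) = (n%:Z)%:E.
Proof.
move=> a_pr; have fX := coset_complex_map R <[a]>%G n.
rewrite /ind; case: pselect => [h|[]]; last by exists n; exact/asboolP.
case: ex_minnP => m /asboolP[f gf] /(_ n (asboolT fX)); rewrite leq_eqVlt.
by case/orP=> [/eqP -> //|mn]; case: (no_map_to_small_EG a_pr mn gf).
Qed.

Lemma ind_ge0 (X : gspace gT) : (0%:E <= ind R X)%E.
Proof.
rewrite /ind; case: pselect => h; last by rewrite leey.
by case: ex_minnP => m _ _; rewrite lee_fin.
Qed.

(** The index of the join is finite, being at most n + 1 and nonnegative, so that
    the subtraction takes place in the integers: n + n + 1 - (n + 1) = n. *)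
Lemma join_defect_ge (X Y : gspace gT) n :
  ind R X = (n%:Z)%:E -> ind R Y = (n%:Z)%:E ->
  (ind R (gjoin R X Y) <= (n.+1%:Z)%:E)%E ->
  join_defect R X Y \is a fin_num /\ ((n%:Z)%:E <= join_defect R X Y)%E.
Proof.
rewrite /join_defect => -> -> iXY; have := ind_ge0 (gjoin R X Y).
case: (ind _ _) iXY => [m| |] //; rewrite !lee_fin => mn m0; split=> //.
lia.
Qed.

End Index.

Theorem corollary1 (R : realType) (gT : finGroupType)
  (nontrivialG : [set: gT]%G != 1%G)
  (not_cyclic_prime_power :
    ~ (cyclic [set: gT]%G /\ exists p m : nat, prime p /\ #|gT| = (p ^ m)%N))
  (not_quaternion :
    ~ (exists k : nat, (3 <= k)%N /\ [set: gT]%G \isog 'Q_((2 ^ k)%N))) :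
  (forall n : nat, (1 <= n)%N ->
     exists X Y : free_gcomplex R gT,
       [/\ ind R (geom R X) = (n%:Z)%:E,
           ind R (geom R Y) = (n%:Z)%:E,
           (ind R (gjoin R (geom R X) (geom R Y)) <= (n.+1%:Z)%:E)%E
         & ((n%:Z)%:E <= join_defect R (geom R X) (geom R Y))%E])
  /\ (forall N : nat,
        exists X Y : free_gcomplex R gT,
          join_defect R (geom R X) (geom R Y) \is a fin_num /\
          ((N%:Z)%:E <= join_defect R (geom R X) (geom R Y))%E).
Proof.
have [a [b [a_pr b_pr ab]]] :=
  disjoint_prime_cycles nontrivialG not_cyclic_prime_power not_quaternion.
pose K c n : free_gcomplex R gT :=
  FreeGComplex (@coset_complex_free gT <[c]>%G n R).
have indK c n : prime #[c]%g -> ind R (geom R (K c n)) = (n%:Z)%:E.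
  exact: ind_coset_complex.
have indJ n : (ind R (gjoin R (geom R (K a n)) (geom R (K b n))) <= (n.+1%:Z)%:E)%E.
  exact/ind_le/coset_join_map.
have defect n := join_defect_ge (indK a n a_pr) (indK b n b_pr) (indJ n).
split=> [n _|n]; exists (K a n), (K b n); last exact: defect.
by split; [exact: indK|exact: indK|exact: indJ|have [] := defect n].
Qed.
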